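(* For all $\omega\in\Omega'$, the property that for each $f\in C_{\mathrm{loc}}(\Omega)$ there exists $\ell_\omega(f)\in\mathbb R$ such that $$\lim_{r\to\infty}\limsup_{n\to\infty}\frac1{|\Lambda_n|}\sum_{x\in\Lambda_n}\Bigl|\frac1{|\Lambda_r|}\sum_{y\in\Lambda_r}f\circ\tau_{x+y}(\omega)-\ell_\omega(f)\Bigr|=0$$ is equivalent to $\omega$ being averaging and ergodic.
   Context: Let $d\ge1$ be an integer and let $E(\mathbb Z^d)$ be the set of ordered nearest-neighbor pairs (edges) of $\mathbb Z^d$. Let $\Omega$ be the set of $\omega\in(0,\infty)^{E(\mathbb Z^d)}$ with $c_\omega(x,y)=c_\omega(y,x)$ for all $(x,y)\in E(\mathbb Z^d)$, where $c_\omega(e)$ denotes the coordinate of $\omega$ at $e$. $\Omega$ carries the product Euclidean topology and the product $\sigma$-algebra $\mathcal F$. For $x\in\mathbb Z^d$ the shift $\tau_x\colon\Omega\to\Omega$ is $\tau_x(\omega)(y,z)=\omega(y+x,z+x)$. For $r\ge0$, $\Lambda_r:=[-r,r]^d\cap\mathbb Z^d$; for $\Lambda\subseteq\mathbb Z^d$, $E(\Lambda)$ is the set of edges incident with at least one vertex of $\Lambda$. $C(\Omega)$ is the set of continuous functions $\Omega\to\mathbb R$ and $C_b(\Omega)$ the subset of bounded ones. $C_{\mathrm{loc}}(\Omega)$ is the set of $f\in C(\Omega)$ for which there is a finite $B\subseteq E(\mathbb Z^d)$ such that $f$ depends only on $\omega$ restricted to $B$ and, regarded as a function on $(0,\infty)^B$,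 has compact support. A configuration $\omega\in\Omega$ is averaging if $\lim_{n\to\infty}\frac1{|\Lambda_n|}\sum_{x\in\Lambda_n}f\circ\tau_x(\omega)$ exists for each $f\in C_{\mathrm{loc}}(\Omega)$. The set of tight configurations is $\Omega':=\{\omega\in\Omega\colon\lim_{\epsilon\downarrow0}\limsup_{n\to\infty}\frac1{n^d}\sum_{e\in E(\Lambda_n)}1_{\mathbb R\smallsetminus[\epsilon,1/\epsilon]}(c_\omega(e))=0\}$. For each averaging $\omega\in\Omega'$ there is a unique probability measure $\mathbb P_\omega$ on $(\Omega,\mathcal F)$ such that $E_{\mathbb P_\omega}(f)=\lim_{n\to\infty}\frac1{|\Lambda_n|}\sum_{x\in\Lambda_n}f\circ\tau_x(\omega)$ (with the limit existing) for all $f\in C_b(\Omega)$, and $\mathbb P_\omega$ is translation invariant. An averaging $\omega\in\Omega'$ is ergodic if $\mathbb P_\omega(A)\in\{0,1\}$ for each $A\in\mathcal F$ with $\tau_x^{-1}(A)=A$ for all $x\in\mathbb Z^d$. *)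

(* Defs.v *)
From HB Require Import structures.
From mathcomp Require Import all_boot all_order all_algebra finmap.
From mathcomp Require Import all_classical all_reals all_analysis.

Set Implicit Arguments.
Unset Strict Implicit.
Unset Printing Implicit Defensive.

Import Order.TTheory GRing.Theory Num.Theory.
Import numFieldNormedType.Exports.

Local Open Scope classical_set_scope.
Local Open Scope ring_scope.

(* The lattice Z^d is the type 'rV[int]_d. *)

Definition nearest_neighbor (d : nat) (p : 'rV[int]_d * 'rV[int]_d) : bool :=
  \sum_(i < d) `|p.1 ord0 i - p.2 ord0 i| == 1.

Definition edge (d : nat) : Type :=
  {p : 'rV[int]_d * 'rV[int]_d | nearest_neighbor p}.

Lemma nearest_neighbor_swap (d : nat) (p : 'rV[int]_d * 'rV[int]_d) :
  nearest_neighbor p -> nearest_neighbor (p.2, p.1).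
Proof.
by move=> /eqP pE; apply/eqP; rewrite -[RHS]pE; apply: eq_bigr => i _ /=;
  rewrite distrC.
Qed.

Lemma nearest_neighbor_shift (d : nat) (x : 'rV[int]_d)
    (p : 'rV[int]_d * 'rV[int]_d) :
  nearest_neighbor p -> nearest_neighbor (p.1 + x, p.2 + x).
Proof.
move=> /eqP pE; apply/eqP; rewrite -[RHS]pE; apply: eq_bigr => i _ /=.
by rewrite !mxE opprD addrACA subrr addr0.
Qed.

Definition edge_rev (d : nat) (e : edge d) : edge d :=
  exist _ ((sval e).2, (sval e).1) (nearest_neighbor_swap (svalP e)).

Definition edge_shift (d : nat) (x : 'rV[int]_d) (e : edge d) : edge d :=
  exist _ ((sval e).1 + x, (sval e).2 + x) (nearest_neighbor_shift x (svalP e)).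

(* (0, oo), with the topology induced from R *)
Definition posreal (R : realType) : Type := [set r : R | 0 < r].

HB.instance Definition _ (R : realType) := Topological.on (posreal R).

(* (0, oo)^I, with the product topology *)
Notation pospower R I := (prod_topology (fun _ : I => posreal R)).

Definition symmetric_config (R : realType) (d : nat) : set (pospower R (edge d)) :=
  [set w | forall e, w (edge_rev e) = w e].

Definition config (R : realType) (d : nat) : Type := @symmetric_config R d.

HB.instance Definition _ (R : realType) (d : nat) :=
  Topological.on (config R d).

Definition poscoord (R : realType) (d : nat) (w : config R d) (e : edge d) :
  posreal R := set_val w e.

Definition conductance (R : realType) (d : nat) (e : edge d) (w : config R d) :
  R := set_val (poscoord w e).

Lemma tau_subproof (R : realType) (d : nat) (x : 'rV[int]_d)
    (w : config R d) :
  (fun e => poscoord w (edge_shift x e)) \in @symmetric_config R d.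
Proof.
apply/mem_set => e; rewrite /poscoord.
have -> : edge_shift x (edge_rev e) = edge_rev (edge_shift x e).
  exact: val_inj.
by have /set_mem := valP w; apply.
Qed.

Definition tau (R : realType) (d : nat) (x : 'rV[int]_d) (w : config R d) :
  config R d := SigSub (tau_subproof x w).

Lemma posreal1_subproof (R : realType) : (1 : R) \in [set r : R | 0 < r].
Proof. exact/mem_set/ltr01. Qed.

Lemma config1_subproof (R : realType) (d : nat) :
  (fun _ => SigSub (posreal1_subproof R)) \in @symmetric_config R d.
Proof. exact/mem_set. Qed.

(* measurableType requires a distinguished point *)
HB.instance Definition _ (R : realType) (d : nat) :=
  isPointed.Build (config R d) (SigSub (config1_subproof R d)).

Definition cylinders (R : realType) (d : nat) : set (set (config R d)) :=
  [set A | exists e : edge d, exists2 B : set R,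
    measurable B & A = conductance e @^-1` B].

HB.instance Definition _ (R : realType) (d : nat) :=
  Measurable.copy (config R d) (g_sigma_algebraType (@cylinders R d)).

Definition Lambda (R : realType) (d : nat) (r : R) : set 'rV[int]_d :=
  [set x | forall i, `|(x ord0 i)%:~R| <= r].
Arguments Lambda {R} d r.

Definition edges_of (d : nat) (L : set 'rV[int]_d) : set (edge d) :=
  [set e | L (sval e).1 \/ L (sval e).2].

(* Only meaningful for finite A: fset_set and \sum_(x \in A) are total. *)
Definition mean (R : realType) (d : nat) (A : set 'rV[int]_d)
    (F : 'rV[int]_d -> R) : R :=
  #|` fset_set A|%:R^-1 * \sum_(x \in A) F x.

(* [g] is [f] regarded as a function on (0, oo)^B; as every [w] is symmetric,
   [f] fixes [g] only on the vectors that agree on an edge and its reversal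
   when [B] contains both. *)
Definition Cloc (R : realType) (d : nat) (f : config R d -> R) : Prop :=
  continuous f /\
  exists (B : set (edge d)) (g : pospower R B -> R),
    [/\ finite_set B,
        forall w, f w = g (fun b => poscoord w (set_val b)) &
        compact (closure [set v | g v != 0])].

Definition averaging (R : realType) (d : nat) (w : config R d) : Prop :=
  forall f, Cloc f ->
    cvg (mean (Lambda d (n%:R : R)) (fun x => f (tau x w)) @[n --> \oo]).

Definition tight (R : realType) (d : nat) (w : config R d) : Prop :=
  (fun eps : R => limn_esup (fun n : nat =>
    ((n%:R ^+ d)^-1 *
     \sum_(e \in edges_of (Lambda d (n%:R : R)))
       (\1_(~` `[eps, 1 / eps]%classic) (conductance e w) : R))%:E))
 @ (0 : R)^'+ --> 0%E.

Definition is_limit_law (R : realType) (d : nat) (w : config R d)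
    (P : probability (config R d) R) : Prop :=
  forall f : config R d -> R, continuous f -> bounded_fun f ->
    (mean (Lambda d (n%:R : R)) (fun x => f (tau x w)))%:E @[n --> \oo]
    --> 'E_P[f]%E.

(* For averaging tight [w], exactly one [P] satisfies [is_limit_law w P], so
   that this [P] is the measure P_w. *)
Definition ergodic (R : realType) (d : nat) (w : config R d) : Prop :=
  exists P : probability (config R d) R, is_limit_law w P /\
    forall A : set (config R d), measurable A ->
      (forall x, tau x @^-1` A = A) -> P A = 0%E \/ P A = 1%E.

(* Main.v *)
(**
Averaging and tight implies a limit law: by tightness, and by compactness of
products of segments [[eps, 1/eps]], every bounded continuous function is
approximated along the orbit of [w] by functions of [Cloc], so its orbit
averages converge; the limit is a positive functional to which the
Daniell-Stone construction applies, tightness and a Dini argument giving its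
continuity along decreasing sequences. The limit law [P] is shift invariant
because cubes form a Folner sequence.

If [P] is ergodic, the mean ergodic theorem says that block averages
[A_r f] tend to [E_P f] in [L^1(P)], and the limsup over [n] in the statement
is [E_P |A_r f - E_P f|]. The ergodic theorem is proved from the parallelogram
law: [E (A_n f)^2] decreases to its infimum up to o(1), hence [A_n f] is Cauchy
in [L^2], and the limsup of a fast subsequence is exactly shift invariant.

Conversely the block condition forces the averages to converge to [l f], and it
passes to [E_P |A_r f - l f| -> 0]. The functions with this property (for some
constant) contain all bounded continuous functions and are closed under linear
combinations and [L^1] limits, so they contain all indicators; for an invariant
event [A] this makes [1_A] almost surely constant.
*)

From HB Require Import structures.
Require Import Defs.
From mathcomp Require Import all_boot all_order all_algebra.
From mathcomp Require Import finmap zify ring lra.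
From mathcomp Require Import all_classical all_reals all_analysis measurable_realfun.

Set Implicit Arguments.
Unset Strict Implicit.
Unset Printing Implicit Defensive.

Import Order.TTheory GRing.Theory Num.Theory.
Import numFieldNormedType.Exports.

Local Open Scope classical_set_scope.
Local Open Scope ring_scope.

(** Tightness controls one edge at a time, and only for [n] beyond a threshold that depends on the
    edge. At a given [n] no bound is available for infinitely many edges at once, hence none for the
    visits to a compact set of configurations. The sets [inK eps k] impose the first [k] constraints
    only; the widths [eps i] are fixed before [k], with failure frequencies summable in [i], so that
    one bound serves all [k]. Compactness returns by contradiction: counterexamples [u k] in
    [inK eps k] converge along an ultrafilter finer than [\oo], since every edge is constrained from
    some [k] on. This device yields both the approximation by functions of finitely many edges and
    Dini's argument; the ultrafilter makes all coordinates converge at once, without diagonal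
    extraction. Ergodicity speaks of events that are invariant at every point, not up to null sets.
    A limit in mean is defined only almost surely and need not give such events; hence the passage
    to a pointwise limsup, for which the estimates on shifts have to be uniform in the
    configuration. *)

Lemma initial_cvg (S : choiceType) (T : topologicalType) (f : S -> T)
    (I : Type) (F : set_system I) (FF : Filter F) (u : I -> S) (s : S) :
  f (u i) @[i --> F] --> f s -> u @ F --> (s : initial_topology f).
Proof.
move=> cvfF A /= [_ [[B Bop <-] Bfs sBfA]].
have FB : nbhs (f s) B by rewrite nbhsE; exists B.
have {cvfF}h := cvfF _ FB; rewrite nbhs_filterE /=.
by move: h; apply: (@filterS _ F) => i Bi; exact: sBfA.
Qed.

(** Compactness of the segment gives a cluster point, and a cluster point of an ultrafilter is a
    limit: otherwise the complement of some neighbourhood would belong to the ultrafilter. *)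
Lemma ultra_bounded_cvg (R : realType) (I : Type) (U : set_system I)
    (UU : UltraFilter U) (x : I -> R) (a b : R) :
  (\forall k \near U, a <= x k <= b) ->
  exists2 p, a <= p <= b & x @ U --> p.
Proof.
move=> xab.
have UP := @ultra_proper _ _ UU.
have PF : ProperFilter (x @ U) := fmap_proper_filter x UP.
have [|p [pab clp]] := @segment_compact R a b (x @ U) PF.
  by apply: filterS xab => k; rewrite /= in_itv.
exists p; first by rewrite /= in_itv /= in pab.
move=> V pV; have [//|UV] := in_ultra_setVsetC (x @^-1` V) UU.
by have [y []] := clp (~` V) V UV pV.
Qed.

(** * Topology of configurations *)

Section configurations.
Variables (R : realType) (d : nat).
Implicit Types (w : config R d) (e : edge d).

Definition mkpos (t : R) (t0 : 0 < t) : posreal R := SigSub (mem_set (t0 : [set r : R | 0 < r] t)).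

Lemma posreal_gt0 (t : posreal R) : 0 < set_val t.
Proof. exact: set_mem (valP t). Qed.

Lemma conductance_gt0 w e : 0 < conductance e w.
Proof. exact: posreal_gt0. Qed.

Lemma conductance_rev w e : conductance (edge_rev e) w = conductance e w.
Proof.
rewrite /conductance /poscoord; congr set_val.
by have /set_mem := valP w; apply.
Qed.

Lemma conductance_tau x w e :
  conductance e (tau x w) = conductance (edge_shift x e) w.
Proof. by []. Qed.

Lemma config_inj w1 w2 :
  (forall e, conductance e w1 = conductance e w2) -> w1 = w2.
Proof.
by move=> h; apply: val_inj; apply/funext => e; apply: val_inj; exact: h.
Qed.

Lemma mkconfig_subproof (c : edge d -> R) (c0 : forall e, 0 < c e) :
  (forall e, c (edge_rev e) = c e) ->
  (fun e => mkpos (c0 e)) \in @symmetric_config R d.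
Proof. by move=> csym; apply/mem_set => e; apply: val_inj; exact: csym. Qed.

Definition mkconfig (c : edge d -> R) (c0 : forall e, 0 < c e)
    (csym : forall e, c (edge_rev e) = c e) : config R d :=
  SigSub (mkconfig_subproof c0 csym).

Lemma conductance_mkconfig c c0 csym e :
  conductance e (@mkconfig c c0 csym) = c e.
Proof. by []. Qed.

Lemma edge_revK e : edge_rev (edge_rev e) = e.
Proof. by apply: val_inj => /=; case: e => -[]. Qed.

Lemma tau_tau x y w : tau x (tau y w) = tau (x + y) w.
Proof.
apply: config_inj => e; rewrite !conductance_tau; congr (conductance _ w).
by apply: val_inj; rewrite /= !addrA.
Qed.

Lemma tau0 w : tau 0 w = w.
Proof.
apply: config_inj => e; rewrite !conductance_tau; congr (conductance _ w).
by apply: val_inj; rewrite /= !addr0; case: e => -[].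
Qed.

Lemma continuous_conductance e : continuous (conductance e : config R d -> R).
Proof.
have c1 : continuous (set_val : config R d -> pospower R (edge d)).
  exact: initial_continuous.
have c2 : continuous (fun w : pospower R (edge d) => w e).
  exact: proj_continuous.
have c3 : continuous (set_val : posreal R -> R) by exact: initial_continuous.
have c4 : continuous (fun w : config R d => poscoord w e).
  move=> w; apply: (@continuous_comp (config R d) (pospower R (edge d))
    (posreal R) set_val (fun v => v e) w); [exact: c1|exact: c2].
move=> w; apply: (@continuous_comp (config R d) (posreal R) R
  (fun w => poscoord w e) set_val w); [exact: c4|exact: c3].
Qed.

Lemma config_cvg (I : Type) (F : set_system I) (FF : Filter F)
    (u : I -> config R d) w :
  (forall e, conductance e (u i) @[i --> F] --> conductance e w) ->
  u @ F --> w.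
Proof.
move=> h; apply: initial_cvg => /=; apply/cvg_sup => e; apply: initial_cvg.
by apply: initial_cvg; exact: h.
Qed.

Lemma continuous_config (T : topologicalType) (u : T -> config R d) :
  (forall e, continuous (conductance e \o u)) -> continuous u.
Proof. by move=> h t; apply: config_cvg => e; exact: h. Qed.

Lemma continuous_tau x : continuous (@tau R d x).
Proof. by apply: continuous_config => e; exact: continuous_conductance. Qed.

(** Tychonoff by hand: the coordinates converge separately along the ultrafilter, the lower bounds
    [a e] keep the limits positive, and symmetry passes to them by uniqueness of limits. *)
Lemma ultra_config_cvg (I : Type) (U : set_system I) (UU : UltraFilter U)
    (u : I -> config R d) (a b : edge d -> R) : (forall e, 0 < a e) ->
  (forall e, \forall k \near U, a e <= conductance e (u k) <= b e) ->
  exists p : config R d, u @ U --> p.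
Proof.
move=> a0 uab; have UP := @ultra_proper _ _ UU.
have /choice [c hc] : forall e, exists c, 
    a e <= c <= b e /\ conductance e (u k) @[k --> U] --> c.
  by move=> e; have [c] := ultra_bounded_cvg UU (uab e); exists c.
have c0 e : 0 < c e by have [/andP[+ _] _] := hc e; exact: lt_le_trans.
have csym e : c (edge_rev e) = c e.
  have [_ h1] := hc (edge_rev e); have [_ h2] := hc e.
  have h3 : conductance (edge_rev e) (u k) @[k --> U] --> c e.
    by under eq_fun do rewrite conductance_rev.
  exact: (cvg_unique _ h1 h3).
exists (mkconfig c0 csym); apply: config_cvg => e; exact: (hc e).2.
Qed.

End configurations.

(** * Inequalities for finite sums *)

Lemma ler_sum_uniq (R : numDomainType) (T : eqType) (s1 s2 : seq T)
    (G : T -> R) : uniq s1 -> uniq s2 -> {subset s1 <= s2} ->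
  (forall x, 0 <= G x) -> \sum_(x <- s1) G x <= \sum_(x <- s2) G x.
Proof.
move=> u1 u2 s12 G0; rewrite [leRHS](bigID (mem s1))/= [leRHS]addrC.
rewrite ler_wpDl ?sumr_ge0// -[leRHS]big_filter le_eqVlt; apply/orP; left.
apply/eqP/perm_big; apply: uniq_perm => //; first exact: filter_uniq.
by move=> x; rewrite mem_filter; case: (boolP (x \in s1)) => //= /s12 ->.
Qed.

Lemma sum_uniq_diff (R : numDomainType) (T : eqType) (s1 s2 : seq T)
    (F : T -> R) (M : R) : uniq s1 -> uniq s2 -> {subset s1 <= s2} ->
  (forall x, `|F x| <= M) ->
  `|\sum_(x <- s2) F x - \sum_(x <- s1) F x| <= M * ((size s2)%:R - (size s1)%:R).
Proof.
move=> u1 u2 s12 FM.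
have p12 : perm_eq [seq x <- s2 | x \in s1] s1.
  apply: uniq_perm => //; first exact: filter_uniq.
  by move=> x; rewrite mem_filter; case: (boolP (x \in s1)) => //= /s12 ->.
rewrite [X in `|X - _|](bigID (mem s1))/= -[X in `|X + _ - _|]big_filter (perm_big _ p12)/= addrC addKr.
rewrite -(count_predC (mem s1) s2) -size_filter (perm_size p12) natrD addrC.
rewrite addKr (le_trans (ler_norm_sum _ _ _))//.
rewrite (le_trans (ler_sum _ (fun x _ => FM x)))//.
by rewrite big_const_seq iter_addr_0 mulr_natr.
Qed.

(** Bernoulli's inequality; it bounds from below the proportion of a cube that lies in a smaller
    concentric cube. *)
Lemma bernoulli_sub (R : realDomainType) (t : R) (d : nat) : 0 <= t <= 1 ->
  1 - d%:R * t <= (1 - t) ^+ d.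
Proof.
move=> /andP[t0 t1]; elim: d => [|d IH]; first by rewrite mul0r subr0 expr0.
have t1' : 0 <= 1 - t by rewrite subr_ge0.
rewrite exprS; apply: le_trans (ler_wpM2l t1' IH).
rewrite -natr1; have : 0 <= d%:R * t * t by rewrite !mulr_ge0.
nra.
Qed.

(** * Averages over boxes *)

Section averages.
Variables (R : realType) (d : nat).
Implicit Types (F G : 'rV[int]_d -> R) (n : nat).

(** A duplicate-free list of the points of [Lambda d n], parametrized by row vectors over a finite
    ordinal so that its size is read off by counting. *)
Definition cube n : seq 'rV[int]_d :=
  [seq (\row_i ((M ord0 i : nat)%:Z - n%:Z)) | M : 'rV['I_n.*2.+1]_d].

Lemma size_cube n : size (cube n) = (n.*2.+1 ^ d)%N.
Proof. by rewrite size_map -cardE card_mx card_ord mul1n. Qed.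

Lemma uniq_cube n : uniq (cube n).
Proof.
rewrite map_inj_uniq ?enum_uniq// => M N /rowP MN.
apply/rowP => i; apply: val_inj => /=; have := MN i.
by rewrite !mxE => /addIr[].
Qed.

Lemma mem_cube n x :
  (x \in cube n) = [forall i, - n%:Z <= x ord0 i <= n%:Z].
Proof.
apply/mapP/forallP => [[M _ ->] i|h].
  by rewrite mxE; move: (nat_of_ord _) (ltn_ord (M ord0 i)) => m; lia.
have hx i : (`|(x ord0 i + n%:Z)%R|%N < n.*2.+1)%N by have := h i; lia.
exists (\row_i (Ordinal (hx i))); first by rewrite mem_enum.
apply/rowP => i; rewrite !mxE /=; have := h i; move: (x ord0 i) => z; lia.
Qed.

Lemma LambdaE n : Lambda d (n%:R : R) = [set` cube n].
Proof.
have E (z : int) : (`|z%:~R| <= n%:R :> R) = (- n%:Z <= z <= n%:Z).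
  by rewrite -[n%:R]/((n%:Z)%:~R) -intr_norm ler_int ler_norml.
apply/seteqP; split => x; rewrite /Lambda /= mem_cube => h.
  by apply/forallP => i; rewrite -E.
by move=> i; have /forallP/(_ i) := h; rewrite -E.
Qed.

Lemma finite_Lambda n : finite_set (Lambda d (n%:R : R)).
Proof. by rewrite LambdaE; exact: finite_seq. Qed.

Lemma perm_cube n : perm_eq (fset_set (Lambda d (n%:R : R))) (cube n).
Proof.
apply: uniq_perm; [exact: fset_uniq|exact: uniq_cube|] => x.
rewrite in_fset_set; last exact: finite_Lambda.
by rewrite LambdaE; apply/idP/idP => [/set_mem|xc]; last exact: mem_set.
Qed.

Definition avg n F : R := (size (cube n))%:R^-1 * \sum_(x <- cube n) F x.

Lemma mean_avg n F : mean (Lambda d (n%:R : R)) F = avg n F.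
Proof.
rewrite /mean /avg (perm_size (perm_cube n)).
rewrite fsbig_finite; last exact: finite_Lambda.
by congr *%R; apply: perm_big; exact: perm_cube.
Qed.

(** Coordinates are integers, so a box only sees the integer part of its radius; the limit over real
    [r] thereby reduces to integer radii. *)
Lemma mean_avg_real (r : R) F : 0 <= r ->
  mean (Lambda d r) F = avg (Num.truncn r) F.
Proof.
move=> r0; have E (z : int) : `|z%:~R| = (absz z)%:R :> R by rewrite -intr_norm natr_absz.
rewrite -mean_avg; congr mean; apply/seteqP; split => x h i;
  by have := h i; rewrite !E ler_nat truncn_ge_nat.
Qed.

Let c n : R := (size (cube n))%:R.

Lemma size_cube_gt0 n : 0 < c n.
Proof. by rewrite /c size_cube ltr0n expn_gt0. Qed.

Lemma avgD n F G : avg n (fun x => F x + G x) = avg n F + avg n G.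
Proof. by rewrite /avg big_split mulrDr. Qed.

Lemma avgZ n a F : avg n (fun x => a * F x) = a * avg n F.
Proof. by rewrite /avg -mulr_sumr mulrCA. Qed.

Lemma avg_cst n a : avg n (fun=> a) = a.
Proof.
rewrite /avg big_const_seq count_predT iter_addr_0 -[a *+ _]mulr_natl mulKf//.
by rewrite gt_eqF ?size_cube_gt0.
Qed.

Lemma avgN n F : avg n (fun x => - F x) = - avg n F.
Proof. by rewrite /avg sumrN mulrN. Qed.

Lemma avgB n F G : avg n (fun x => F x - G x) = avg n F - avg n G.
Proof. by rewrite avgD avgN. Qed.

Lemma le_avg n F G : (forall x, F x <= G x) -> avg n F <= avg n G.
Proof.
by move=> FG; rewrite ler_wpM2l ?invr_ge0 ?ler0n// ler_sum.
Qed.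

Lemma avg_ge0 n F : (forall x, 0 <= F x) -> 0 <= avg n F.
Proof. by move=> F0; rewrite -(avg_cst n 0); exact: le_avg. Qed.

Lemma ler_avg_norm n F : `|avg n F| <= avg n (fun x => `|F x|).
Proof.
rewrite normrM ger0_norm ?invr_ge0 ?ler0n//.
by rewrite ler_wpM2l ?invr_ge0 ?ler0n// ler_norm_sum.
Qed.

Lemma avg_bounded n F M : (forall x, `|F x| <= M) -> `|avg n F| <= M.
Proof.
move=> FM; rewrite (le_trans (ler_avg_norm _ _))//.
by rewrite -[leRHS](avg_cst n); exact: le_avg.
Qed.

Lemma avg_exchange n m (F : 'rV[int]_d -> 'rV[int]_d -> R) :
  avg n (fun x => avg m (F x)) = avg m (fun y => avg n (F ^~ y)).
Proof.
by rewrite /avg -!mulr_sumr exchange_big/= mulrCA.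
Qed.

Lemma avg_sum n (k : nat) (F : nat -> 'rV[int]_d -> R) :
  avg n (fun x => \sum_(i < k) F i x) = \sum_(i < k) avg n (F i).
Proof. by rewrite /avg exchange_big /= mulr_sumr. Qed.

(** Translated by [- y], the smaller cube still fits into [cube n], and there the summands
    [F (x + y)] reproduce the sum of [F] over the untranslated smaller cube. Only the remaining
    points contribute. *)
Lemma cube_shift_diff n k (y : 'rV[int]_d) F (M : R) : (k <= n)%N ->
  (forall i, - k%:Z <= y ord0 i <= k%:Z) -> (forall x, `|F x| <= M) ->
  `|\sum_(x <- cube n) F (x + y) - \sum_(x <- cube (n - k)) F x| <=
  M * (c n - c (n - k)).
Proof.
move=> kn yk FM.
have -> : \sum_(x <- cube (n - k)) F x =
    \sum_(x <- [seq x - y | x <- cube (n - k)]) F (x + y).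
  by rewrite [RHS]big_map; apply: eq_bigr => x _; rewrite subrK.
rewrite /c -(size_map (fun x => x - y) (cube (n - k))).
apply: sum_uniq_diff => //.
- by rewrite map_inj_uniq ?uniq_cube//; exact: addIr.
- exact: uniq_cube.
- move=> _ /mapP[x + ->]; rewrite !mem_cube => /forallP h; apply/forallP => i.
  rewrite !mxE; have := h i; have := yk i.
  move: (x ord0 i) (y ord0 i) => a b; lia.
Qed.

(** The Folner property of cubes: both averages are compared with the sum over [cube (n - k)]. The
    threshold depends on [y] and [dl] alone, which later allows functions that vary with [n] or with
    the configuration. *)
Lemma avg_shift (y : 'rV[int]_d) (dl : R) : 0 < dl -> exists N, forall n, (N <= n)%N ->
  forall F M, (forall x, `|F x| <= M) ->
  `|avg n (fun x => F (x + y)) - avg n F| <= M * dl.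
Proof.
move=> dl0.
have [k yk] : exists k : nat, forall i, - k%:Z <= y ord0 i <= k%:Z.
  exists (\max_i `|y ord0 i|%N) => i.
  have := leq_bigmax (F := fun i => `|y ord0 i|%N) i.
  by move: (\max__ _)%N (y ord0 i) => m z; lia.
(* One factor 2 comes from comparing both sums with the smaller cube, the other from the [k] layers
   lost at each of the two ends of a side. *)
have : \forall n \near \oo, 4 * d%:R * k%:R / dl <= (n%:R : R).
  exact: nbhs_infty_ger.
case=> N _ hN; exists (maxn N k) => n; rewrite geq_max => /andP[Nn kn] F M FM.
have M0 : 0 <= M by exact: le_trans (FM 0).
have := hN _ Nn; rewrite /= ler_pdivrMr// => {}hN.
have h1 := cube_shift_diff kn yk FM.
have h2 : `|\sum_(x <- cube n) F x - \sum_(x <- cube (n - k)) F x| <=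
    M * (c n - c (n - k)).
  have := @cube_shift_diff n k 0 F M kn; under eq_bigr do rewrite addr0.
  by apply => // i; rewrite mxE; lia.
have h3 : `|\sum_(x <- cube n) F (x + y) - \sum_(x <- cube n) F x| <=
    M * (2 * (c n - c (n - k))).
  by move: h1 h2; rewrite !ler_norml => /andP[? ?] /andP[? ?]; apply/andP; split; lra.
rewrite /avg -mulrBr normrM ger0_norm ?invr_ge0 ?ler0n//.
rewrite ler_pdivrMl ?size_cube_gt0// mulrC (le_trans h3)// -mulrA ler_wpM2l//.
have n0 : 0 < n.*2.+1%:R :> R by rewrite ltr0n.
(* [1 - t] is the ratio of the sides [2 (n - k) + 1] and [2 n + 1], so that the proportion of lost
   points is at most [d t]. *)
set t : R := k.*2%:R / n.*2.+1%:R.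
have t01 : 0 <= t <= 1.
  rewrite /t divr_ge0 ?ler0n//= ler_pdivrMr// mul1r ler_nat.
  by rewrite (leq_trans (_ : _ <= n.*2)%N)// leq_double.
have := bernoulli_sub d t01.
have -> : (1 - t) ^+ d = c (n - k) / c n.
  rewrite /c !size_cube !natrX -expr_div_n; congr (_ ^+ d).
  rewrite /t -{1}(mulfV (lt0r_neq0 n0)) -mulrBl; congr (_ / _).
  by rewrite -natrB; [congr (_%:R)|]; lia.
move=> hb; have cn0 := size_cube_gt0 n.
have : c n - c (n - k) <= d%:R * t * c n.
  have : (1 - d%:R * t) * c n <= c (n - k) by rewrite -ler_pdivlMr.
  by rewrite mulrBl mul1r lerBlDr addrC -lerBlDr.
have : d%:R * t * 2 <= dl.
  have k2 : k.*2%:R = 2 * k%:R :> R by rewrite -muln2 natrM mulrC.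
  have n2 : n.*2.+1%:R = 2 * n%:R + 1 :> R by rewrite -natr1 -muln2 natrM mulrC.
  rewrite /t mulrA -mulrA [_^-1 * _]mulrC mulrA ler_pdivrMr// k2 n2.
  have : 0 <= n%:R * dl by rewrite mulr_ge0// ltW.
  by move: hN dl0; clear; lra.
move: cn0; set u := d%:R * t; set C := c n; set D := c (n - k).
clear; nra.
Qed.

(** After exchanging the two averages the inner one is a shift by [y]; only finitely many [y] occur,
    so the thresholds of [avg_shift] have a maximum. *)
Lemma avg_avg r (dl : R) : 0 < dl -> exists N, forall n, (N <= n)%N ->
  forall F M, (forall x, `|F x| <= M) ->
  `|avg n (fun x => avg r (fun y => F (x + y))) - avg n F| <= M * dl.
Proof.
move=> dl0.
have [N hN] : exists N, forall n, (N <= n)%N -> forall y, y \in cube r ->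
    forall F M, (forall x, `|F x| <= M) ->
    `|avg n (fun x => F (x + y)) - avg n F| <= M * dl.
  elim: (cube r) => [|y s [N hN]]; first by exists 0%N.
  have [N' hN'] := avg_shift y dl0; exists (maxn N N') => n.
  rewrite geq_max => /andP[Nn N'n] z; rewrite inE => /predU1P[->|zs].
    exact: hN'.
  exact: hN.
exists N => n Nn F M FM.
rewrite (avg_exchange n r (fun x y => F (x + y))).
rewrite -[X in _ - X](avg_cst r) -avgB (le_trans (ler_avg_norm _ _))//.
rewrite -[leRHS](avg_cst r) ler_wpM2l ?invr_ge0 ?ler0n//.
by rewrite big_seq [leRHS]big_seq ler_sum// => y ys; exact: hN.
Qed.

End averages.

(** * Compact exhaustion and local functions *)

Section exhaustion.
Variables (R : realType) (d : nat).
Implicit Types (w : config R d) (e : edge d) (eps : nat -> R) (k : nat).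

Definition code e : nat := choice.pickle (sval e).

(** Edges are numbered through the ambient type of pairs; an index that numbers no edge gives [None]
    and later carries no constraint. *)
Definition decode (i : nat) : option (edge d) :=
  obind (fun p => insub p : option {p : 'rV[int]_d * 'rV[int]_d | nearest_neighbor p})
    (choice.pickle_inv i).

Lemma codeK : pcancel code decode.
Proof.
move=> e; rewrite /decode /code choice.pickleK_inv /=.
by case: e => p hp; rewrite /= insubT; congr Some; apply: val_inj.
Qed.

Lemma decodeK : ocancel decode code.
Proof.
move=> i; rewrite /decode; have := @choice.pickle_invK ('rV[int]_d * 'rV[int]_d)%type i.
case: (choice.pickle_inv i) => [p|//] /= <-.
by case: insubP => //= e _ ep; rewrite /code -ep.
Qed.

(* [idx] is invariant under edge reversal, so truncating at [idx e < k] keeps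
   configurations symmetric. *)
Definition idx e : nat := minn (code e) (code (edge_rev e)).

Lemma idx_rev e : idx (edge_rev e) = idx e.
Proof. by rewrite /idx edge_revK minnC. Qed.

Lemma idxP e : idx e = code e \/ idx e = code (edge_rev e).
Proof. by rewrite /idx /minn; case: ifP; [left|right]. Qed.

Definition good eps (i : nat) w : bool :=
  if decode i is Some e then eps i <= conductance e w <= (eps i)^-1 else true.

Definition inK eps k w : bool := [forall i : 'I_k, good eps i w].

(** [idx e] is the code of [e] or of its reversal, and both have the same conductance. *)
Lemma inKP eps k w : inK eps k w -> forall e, (idx e < k)%N ->
  eps (idx e) <= conductance e w <= (eps (idx e))^-1.
Proof.
move=> /forallP h e ek; have := h (Ordinal ek); rewrite /good /=.
have [->|->] := idxP e; first by rewrite codeK.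
by rewrite codeK conductance_rev.
Qed.

Lemma rho_gt0 k w e : 0 < (if (idx e < k)%N then conductance e w else 1).
Proof. by case: ifP => // _; exact: conductance_gt0. Qed.

Lemma rho_sym k w e :
  (if (idx (edge_rev e) < k)%N then conductance (edge_rev e) w else 1) =
  (if (idx e < k)%N then conductance e w else 1).
Proof. by rewrite idx_rev conductance_rev. Qed.

(** All but finitely many edges are reset to the conductance 1, so that composing with [rho k] turns
    any function into one of finitely many edges. *)
Definition rho k w : config R d := mkconfig (rho_gt0 k w) (rho_sym k w).

Lemma continuous_rho k : continuous (rho k).
Proof.
apply: continuous_config => e w /=.
have [ek|ek] := boolP (idx e < k)%N.
  rewrite (_ : _ \o _ = conductance e); first exact: continuous_conductance.
  by apply/funext => v; rewrite /= conductance_mkconfig ek.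
rewrite (_ : _ \o _ = cst 1); first exact: cst_continuous.
by apply/funext => v; rewrite /= conductance_mkconfig (negbTE ek).
Qed.

(** The hypothesis is about codes while [rho] keeps edges by [idx]; an edge kept only on account of
    its reversal is recovered from it by symmetry. *)
Lemma rho_eq k w w' :
  (forall e, (code e < k)%N -> conductance e w = conductance e w') ->
  rho k w = rho k w'.
Proof.
move=> h; apply: config_inj => e; rewrite !conductance_mkconfig.
case: ifP => // ek; have [ee|ee] := idxP e; rewrite ee in ek; first exact: h.
by rewrite -[LHS]conductance_rev -[RHS]conductance_rev h.
Qed.

Lemma ultra_infty : exists U : set_system nat, UltraFilter U /\ \oo `<=` U.
Proof. exact: ultraFilterLemma. Qed.

(** The edge [e] is constrained by [inK eps k] as soon as [k] exceeds [idx e], hence on a set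
    belonging to any ultrafilter finer than [\oo]. *)
Lemma inK_cvg eps (u : nat -> config R d) (U : set_system nat)
    (UU : UltraFilter U) : \oo `<=` U -> (forall i, 0 < eps i) ->
  (forall k, inK eps k (u k)) -> exists p : config R d, u @ U --> p.
Proof.
move=> oU eps0 uK.
apply: (@ultra_config_cvg _ _ _ _ UU u (fun e => eps (idx e))
  (fun e => (eps (idx e))^-1)) => // e.
apply: oU; exists (idx e).+1 => // k /= ek.
exact: (inKP (uK k)).
Qed.

Lemma rho_cvg (u : nat -> config R d) (U : set_system nat) (FU : Filter U) (p : config R d) :
  \oo `<=` U -> u @ U --> p -> (fun k => rho k (u k)) @ U --> p.
Proof.
move=> oU up; apply: config_cvg => e.
have c : conductance e (u k) @[k --> U] --> conductance e p.
  by apply: (cvg_comp _ _ up); exact: continuous_conductance.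
apply: cvg_trans c; apply: near_eq_cvg; apply: oU; exists (idx e).+1 => // k /= ek.
by rewrite conductance_mkconfig ek.
Qed.

(** Counterexamples [u k] for every [k] would converge along an ultrafilter to some [p]. Each
    coordinate of [rho k (u k)] is eventually that of [u k], so the truncations converge to [p] as
    well, and continuity at [p] gives a contradiction. *)
Lemma rho_approx eps (f : config R d -> R) (eta : R) : (forall i, 0 < eps i) ->
  continuous f -> 0 < eta ->
  exists k, forall v, inK eps k v -> `|f v - f (rho k v)| <= eta.
Proof.
move=> eps0 cf eta0; apply: contrapT => /forallNP h.
have /choice [u hu] : forall k, exists v,
    inK eps k v /\ eta < `|f v - f (rho k v)|.
  move=> k; have /existsNP [v /not_implyP [vK /negP]] := h k.
  by rewrite -ltNge; exists v.
have [U [UU oU]] := ultra_infty.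
have UP := @ultra_proper _ _ UU.
have [p up] := @inK_cvg eps u U UU oU eps0 (fun k => (hu k).1).
have c1 : f (u k) @[k --> U] --> f p by apply: (cvg_comp _ _ up); exact: cf.
have c2 : f (rho k (u k)) @[k --> U] --> f p.
  by apply: (cvg_comp _ _ (rho_cvg _ oU up)); exact: cf.
have c3 : (f (u k) - f (rho k (u k))) @[k --> U] --> 0.
  by rewrite -(subrr (f p)); exact: cvgB.
have /cvgr0Pnorm_lt/(_ _ eta0) h4 := c3.
have [k] := filter_ex h4.
by rewrite ltNge ltW// (hu k).2.
Qed.

(** Dini's theorem on the sets [inK eps k], which shrink with [k]. If [f k (u k)] exceeded [eta] for
    all [k], a limit [p] of the [u k] would have [f m p < eta] for some [m], and monotonicity would
    give [f k (u k) <= f m (u k) < eta] for suitable [k >= m]. *)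
Lemma dini_inK eps (f : nat -> config R d -> R) (eta : R) :
  (forall i, 0 < eps i) -> (forall k, continuous (f k)) ->
  (forall k v, f k.+1 v <= f k v) ->
  (forall v, f k v @[k --> \oo] --> 0) -> 0 < eta ->
  exists k, forall v, inK eps k v -> f k v <= eta.
Proof.
move=> eps0 cf fdec f0 eta0; apply: contrapT => /forallNP h.
have /choice [u hu] : forall k, exists v, inK eps k v /\ eta < f k v.
  move=> k; have /existsNP [v /not_implyP [vK /negP]] := h k.
  by rewrite -ltNge; exists v.
have [U [UU oU]] := ultra_infty.
have UP := @ultra_proper _ _ UU.
have [p up] := @inK_cvg eps u U UU oU eps0 (fun k => (hu k).1).
have [m fm] : exists m, f m p < eta.
  have /cvgr0Pnorm_lt/(_ _ eta0) h4 := f0 p.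
  by have [m hm] := filter_ex h4; exists m; apply: le_lt_trans hm; exact: ler_norm.
have c1 : f m (u k) @[k --> U] --> f m p by apply: (cvg_comp _ _ up); exact: cf.
have {}h : \forall k \near U, f m (u k) < eta by exact: (cvgr_lt (f m p)).
have h2 : \forall k \near U, (m <= k)%N by apply: oU; exists m.
have [k [/= k1 k2]] := filter_ex (filterI h h2).
have mono j : f (m + j)%N (u k) <= f m (u k).
  elim: j => [|j IH]; first by rewrite addn0.
  by rewrite addnS (le_trans (fdec _ _)).
have := (hu k).2; rewrite ltNge; apply/negP; rewrite negbK.
by have := mono (k - m)%N; rewrite subnKC// => /le_trans->//; exact: ltW.
Qed.

End exhaustion.

(** * Boundedness and construction of functions in [Cloc] *)

Section local_functions.
Variables (R : realType) (d : nat).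
Implicit Types (w : config R d) (e : edge d) (f : config R d -> R).

(** Continuity is known for [f] and not for [g], so a maximum of [g] on the compact support is not
    at hand. Instead the support confines the conductances on [B]; a sequence along which [f] is
    unbounded, normalized off [B], then converges along an ultrafilter, where [f] is locally
    bounded. *)
Lemma Cloc_bounded f : Cloc f -> exists M : R, forall w, `|f w| <= M.
Proof.
move=> [cf [B [g [finB fg gK]]]].
set K := closure _ in gK.
have KP w : f w != 0 -> K (fun b => poscoord w (set_val b)).
  by move=> fw; apply: subset_closure; rewrite /= -fg.
(* One bound on [t + 1 / t] keeps [t] both bounded and away from 0. *)
have /choice [M HM] : forall e, exists M : R, 0 <= M /\
    forall b : B, set_val b = e -> forall v, K v ->
    set_val (v b) + (set_val (v b))^-1 <= M.
  move=> e; have [Be|nBe] := pselect (B e); last first.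
    by exists 0; split=> // b be; exfalso; apply: nBe; rewrite -be; exact: set_valP.
  pose b0 : B := SigSub (mem_set Be).
  pose h (v : pospower R B) : R := set_val (v b0) + (set_val (v b0))^-1.
  have ch : continuous h.
    have c2 : continuous (fun v : pospower R B => v b0) by exact: proj_continuous.
    have c3 : continuous (set_val : posreal R -> R) by exact: initial_continuous.
    have c4 : continuous (fun v : pospower R B => set_val (v b0)).
      move=> v; apply: (@continuous_comp (pospower R B) (posreal R) R
        (fun v => v b0) set_val v); [exact: c2|exact: c3].
    move=> v; have n0 : set_val (v b0) != 0 by rewrite gt_eqF// posreal_gt0.
    exact: (cvgD (c4 v) (cvgV n0 (c4 v))).
  have : compact (h @` K) by apply: continuous_compact => //; exact: continuous_subspaceT.
  move=> /compact_bounded [M0 [M0r hM0]].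
  exists (`|M0| + 1); split; first by rewrite addr_ge0.
  move=> b be v Kv; have -> : b = b0 by apply: val_inj.
  have := hM0 (`|M0| + 1); rewrite (le_lt_trans (ler_norm M0)) ?ltrDl//.
  move=> /(_ isT (h v)) H; apply: le_trans (H _); first exact: ler_norm.
  by exists v.
apply: contrapT => /forallNP h.
have /choice [u hu] : forall n : nat, exists w, n%:R < `|f w|.
  move=> n; have /existsNP [w /negP] := h n%:R.
  by rewrite -ltNge; exists w.
(* The symmetric closure of [B]: resetting edges outside it to 1 preserves symmetry and does not
   change the value of [f]. *)
pose S e := `[< B e \/ B (edge_rev e) >].
have Ssym e : S (edge_rev e) = S e.
  by apply: asbool_equiv_eq; rewrite edge_revK; tauto.
have c0 n e : 0 < (if S e then conductance e (u n) else 1).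
  by case: ifP => // _; exact: conductance_gt0.
have csym n e : (if S (edge_rev e) then conductance (edge_rev e) (u n) else 1)
    = (if S e then conductance e (u n) else 1).
  by rewrite Ssym conductance_rev.
pose u' n := mkconfig (c0 n) (csym n).
have fu n : f (u' n) = f (u n).
  rewrite !fg; congr g; apply/funext => b; apply: val_inj.
  rewrite -[LHS]/(conductance (set_val b) (u' n)) conductance_mkconfig.
  by rewrite /S asboolT//; left; exact: set_valP.
have MS n e : B e -> conductance e (u n) + (conductance e (u n))^-1 <= M e.
  move=> Be; pose b0 : B := SigSub (mem_set Be).
  apply: ((HM e).2 b0 erefl (fun b => poscoord (u n) (set_val b))).
  by apply: KP; rewrite -normr_gt0 (le_lt_trans _ (hu n)).
(* The summand 1 serves the edges that were reset; the other two serve an edge of which only one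
   orientation lies in [B]. *)
pose b e := 1 + M e + M (edge_rev e).
have Me0 e : 0 <= M e by have [] := HM e.
have b1 e : 1 <= b e by rewrite /b -addrA lerDl addr_ge0.
have b0 e : 0 < b e by apply: lt_le_trans (b1 e).
have bnd n e : (b e)^-1 <= conductance e (u' n) <= b e.
  rewrite conductance_mkconfig; case: ifPn => [/asboolP Se|_]; last first.
    by rewrite b1 invf_le1 ?b1 ?b0.
  have cp := conductance_gt0 (u n) e.
  have : conductance e (u n) + (conductance e (u n))^-1 <= b e.
    case: Se => Se; have := MS n _ Se; rewrite ?conductance_rev => /le_trans; apply.
      by rewrite /b addrAC -lerBlDr subrr addr_ge0.
    by rewrite /b -lerBlDr subrr addr_ge0.
  have ci : 0 < (conductance e (u n))^-1 by rewrite invr_gt0.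
  move=> hb; rewrite invf_ple ?posrE//; apply/andP; split; lra.
have [U [UU oU]] := ultra_infty.
have UP := @ultra_proper _ _ UU.
have [p up] : exists p : config R d, u' @ U --> p.
  apply: (@ultra_config_cvg _ _ _ _ UU u' (fun e => (b e)^-1) b) => e.
    by rewrite invr_gt0.
  exact: nearW.
have c1 : `|f (u' k)| @[k --> U] --> `|f p|.
  by apply: cvg_norm; apply: (cvg_comp _ _ up); exact: cf.
have {}h : \forall k \near U, `|f (u' k)| < `|f p| + 1.
  by apply: (cvgr_lt _ c1); rewrite ltrDl.
have h2 : \forall k \near U, `|f p| + 1 <= k%:R.
  by apply: oU; exact: nbhs_infty_ger.
have [k [/= k1 k2]] := filter_ex (filterI h h2).
by have := hu k; rewrite -fu ltNge (le_trans (ltW k1)).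
Qed.

(** The set is the image of a real segment under [max t a], a total continuous map into the positive
    reals. *)
Lemma posreal_segment_compact (a b : R) : 0 < a ->
  compact [set t : posreal R | a <= set_val t <= b].
Proof.
move=> a0.
have h t : 0 < Num.max t a by rewrite lt_max a0 orbT.
pose m (t : R) : posreal R := mkpos (h t).
have cm : continuous m.
  move=> t; apply: initial_cvg => /=.
  by apply: (@continuous_max R R id (cst a) t) => //; exact: cst_continuous.
rewrite (_ : [set _ | _] = m @` `[a, b]).
  apply: continuous_compact; first exact: continuous_subspaceT.
  exact: segment_compact.
apply/seteqP; split => [t /= tab|_ /= [t + <-]].
  exists (set_val t); first by rewrite in_itv.
  by apply: val_inj; apply/max_idPl; case/andP: tab.
by rewrite in_itv /= => /andP[ta tb]; have -> : set_val (m t) = t; [exact/max_idPl|apply/andP].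
Qed.

(** A vector indexed by [B] need not come from a symmetric configuration; [g] is set to 0 on those
    that do not. Its support then lies in a product of segments, which is compact by Tychonoff and
    closed. *)
Lemma Cloc_intro f (B : set (edge d)) (a b : edge d -> R) :
  continuous f -> finite_set B -> (forall e, 0 < a e) ->
  (forall w w', (forall e, B e -> conductance e w = conductance e w') ->
     f w = f w') ->
  (forall w, f w != 0 -> forall e, B e -> a e <= conductance e w <= b e) ->
  Cloc f.
Proof.
move=> cf finB a0 floc fsupp; split => //.
pose res w : pospower R B := fun b => poscoord w (set_val b).
pose g (v : pospower R B) : R :=
  if pselect (exists w, v = res w) is left h then f (sval (cid h)) else 0.
exists B, g; split => //.
  move=> w; rewrite /g; case: pselect => [h|]; last by case; exists w.
  case: cid => w' /= hw; apply: floc => e Be.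
  by rewrite /conductance -[poscoord w e]/(res w (SigSub (mem_set Be))) [res w _]
    (congr1 (fun v => v _) hw).
pose Q : set (pospower R B) :=
  [set v | forall i : B, [set t : posreal R | a (set_val i) <= set_val t <= b (set_val i)] (v i)].
have cQ : compact Q.
  exact: (@tychonoff B (fun=> posreal R) (fun i =>
    [set t : posreal R | a (set_val i) <= set_val t <= b (set_val i)])
    (fun i => @posreal_segment_compact _ _ (a0 (set_val i)))).
have clQ : closed Q.
  rewrite (_ : Q = \bigcap_(i in [set: B])
     ((fun v : pospower R B => set_val (v i)) @^-1` `[a (set_val i), b (set_val i)])); last first.
    apply/seteqP; split => v h i; first by move=> _ /=; rewrite in_itv /=; exact: h.
    by have := h i I; rewrite /= in_itv.
  apply: closed_bigI => i _; apply: preimage_closed; last exact: itv_closed.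
  move=> v _; apply: (@continuous_comp (pospower R B) (posreal R) R
     (fun v => v i) set_val v); first exact: proj_continuous.
  exact: initial_continuous.
apply: (subclosed_compact _ cQ); first exact: closed_closure.
move: (clQ) => /closure_id ->; apply: closureS => v /=.
rewrite /g; case: pselect => [h|]; last by rewrite eqxx.
move=> fn0 i /=; case: cid fn0 => w' /= -> fn0.
by apply: fsupp => //; exact: set_valP.
Qed.

End local_functions.

Lemma limn_esup_lt (R : realType) (u : nat -> \bar R) (a : \bar R) :
  (limn_esup u < a)%E -> exists N, forall n, (N <= n)%N -> (u n < a)%E.
Proof.
move=> /ereal_inf_lt [_ [V [N _ NV] <-] uV]; exists N => n Nn.
by apply: le_lt_trans uV; apply: ereal_sup_ubound; exists n => //; exact: NV.
Qed.

(** * Cutoffs, tightness along the orbit, approximation by local functions *)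

Section cutoffs.
Variable R : realType.

(** A trapezoid: for [a > 0] it is 1 on [[a, 1 / a]], vanishes outside [[a / 2, 2 / a]] and is
    linear in between. *)
Definition psi (a t : R) : R :=
  Num.max 0 (Num.min 1 (Num.min (2 * t / a - 1) (2 - a * t))).

Lemma psi_ge0 a t : 0 <= psi a t.
Proof. by rewrite /psi le_max lexx. Qed.

Lemma psi_le1 a t : psi a t <= 1.
Proof. by rewrite /psi ge_max ler01 ge_min lexx. Qed.

Lemma psi1 a t : 0 < a -> a <= t <= a^-1 -> psi a t = 1.
Proof.
move=> a0 /andP[at1 at2].
have h1 : 1 <= 2 * t / a - 1 by rewrite lerBrDr ler_pdivlMr//; lra.
have h2 : a * t <= 1 by rewrite mulrC -ler_pdivlMr// div1r.
have h3 : 1 <= 2 - a * t by lra.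
rewrite /psi; have -> : Num.min 1 (Num.min (2 * t / a - 1) (2 - a * t)) = 1.
  by apply/min_idPl; rewrite le_min h1.
exact/max_idPr.
Qed.

Lemma psi_supp a t : 0 < a -> psi a t != 0 -> a / 2 <= t <= 2 / a.
Proof.
move=> a0; rewrite /psi neq_lt ltNge le_max lexx/= lt_max ltxx/= !lt_min ltr01/=.
rewrite subr_gt0 ltr_pdivlMr// => /andP[h1 h2].
have h3 : t <= 2 / a by rewrite ler_pdivlMr//; lra.
rewrite h3 andbT; lra.
Qed.

Lemma continuous_psi a : continuous (psi a).
Proof.
have cid : continuous (id : R -> R) by move=> x; exact: cvg_id.
have cc (b : R) : continuous (cst b : R -> R) by exact: cst_continuous.
have c1 : continuous (fun t : R => 2 * t / a - 1).
  move=> t; apply: cvgB; last exact: cvg_cst.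
  by apply: cvgM; [apply: cvgM; [exact: cvg_cst|exact: cvg_id]|exact: cvg_cst].
have c2 : continuous (fun t : R => 2 - a * t).
  move=> t; apply: cvgB; first exact: cvg_cst.
  by apply: cvgM; [exact: cvg_cst|exact: cvg_id].
have c3 t := @continuous_min R R _ _ t (c1 t) (c2 t).
have c4 t := @continuous_min R R _ _ t (cc 1 t) (c3 t).
by move=> t; exact: (@continuous_max R R _ _ t (cc 0 t) (c4 t)).
Qed.

End cutoffs.

Section approximation.
Variables (R : realType) (d : nat).
Implicit Types (w : config R d) (e : edge d) (eps : nat -> R) (k : nat).

(** A continuous substitute for the indicator of [inK eps k]. *)
Definition chi eps k w : R :=
  \prod_(i < k) (if decode d i is Some e then psi (eps i) (conductance e w) else 1).

Lemma continuous_chi eps k : continuous (chi eps k : config R d -> R).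
Proof.
elim: k => [|k IH].
  rewrite (_ : chi _ _ = cst 1); first exact: cst_continuous.
  by apply/funext => w; rewrite /chi big_ord0.
rewrite (_ : chi _ _ = fun w => chi eps k w *
  (if decode d k is Some e then psi (eps k) (conductance e w) else 1)); last first.
  by apply/funext => w; rewrite /chi big_ord_recr.
have h : continuous (fun w : config R d =>
    if decode d k is Some e then psi (eps k) (conductance e w) else 1).
  case: (decode d k) => [e|]; last exact: cst_continuous.
  move=> w; apply: (@continuous_comp _ _ _ (conductance e) (psi (eps k))).
    exact: continuous_conductance.
  exact: continuous_psi.
by move=> w; exact: (cvgM (IH w) (h w)).
Qed.

Lemma chi_itv eps k w : 0 <= chi eps k w <= 1.
Proof.
rewrite /chi; apply: (big_ind (fun x : R => 0 <= x <= 1)).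
- by rewrite ler01 lexx.
- by move=> x y /andP[x0 x1] /andP[y0 y1]; rewrite mulr_ge0//= mulr_ile1.
- move=> i _; case: (decode d i) => [e|]; last by rewrite ler01 lexx.
  by rewrite psi_ge0 psi_le1.
Qed.

Lemma chi1 eps k w : (forall i, 0 < eps i) -> inK eps k w -> chi eps k w = 1.
Proof.
move=> e0 /forallP wK; rewrite /chi big1// => i _; have := wK i; rewrite /good.
by case: (decode d i) => // e; exact: psi1.
Qed.

Lemma chi_supp eps k w e : (forall i, 0 < eps i) -> chi eps k w != 0 ->
  (code e < k)%N -> eps (code e) / 2 <= conductance e w <= 2 / eps (code e).
Proof.
move=> e0 /prodf_neq0 h ek; have := h (Ordinal ek) isT; rewrite /= codeK.
exact: psi_supp.
Qed.

Lemma finite_code_lt k : finite_set [set e : edge d | (code e < k)%N].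
Proof.
pose E := {p : 'rV[int]_d * 'rV[int]_d | nearest_neighbor p}.
apply: (@sub_finite_set E _ [set` pmap (@decode d : nat -> option E) (iota 0 k)]); last first.
  exact: finite_seq.
move=> e /= ek; rewrite mem_pmap; apply/mapP; exists (code e).
  by rewrite mem_iota.
by rewrite codeK.
Qed.

(** [rho k] provides the dependence on finitely many edges, [chi] the compact support. *)
Lemma Cloc_rho_chi eps k (f : config R d -> R) : (forall i, 0 < eps i) ->
  continuous f -> Cloc (fun w => f (rho k w) * chi eps k w).
Proof.
move=> e0 cf.
apply: (@Cloc_intro _ _ _ [set e | (code e < k)%N]
  (fun e => eps (code e) / 2) (fun e => 2 / eps (code e))).
- have c1 : continuous (fun w => f (rho k w)).
    move=> w; apply: (@continuous_comp _ _ _ (rho k) f); last exact: cf.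
    exact: continuous_rho.
  have c2 : continuous (chi eps k : config R d -> R) by exact: continuous_chi.
  by move=> w; exact: (cvgM (c1 w) (c2 w)).
- exact: finite_code_lt.
- by move=> e; rewrite divr_gt0.
- move=> w w' ww'; rewrite (rho_eq ww'); congr (_ * _); apply: eq_bigr => i _.
  case di : (decode d i) => [e|//]; congr psi; apply: ww' => /=.
  by have := decodeK d i; rewrite di /= => ->.
- move=> w fw e ek; apply: (@chi_supp eps k) => //.
  by apply: contra_neq fw => ->; rewrite mulr0.
Qed.

Lemma edge_shift_inj (x y : 'rV[int]_d) e :
  edge_shift x e = edge_shift y e -> x = y.
Proof. by move=> /(congr1 (fun e => (sval e).1)) /= /addrI. Qed.

(** Both endpoints of an edge meeting the box lie in the box of radius [n + 1]. *)
Lemma finite_edges_of n : finite_set (edges_of (Lambda d (n%:R : R))).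
Proof.
pose A := Lambda d (n.+1%:R : R).
pose E := {p : 'rV[int]_d * 'rV[int]_d | nearest_neighbor p}.
have : finite_set (@sval _ _ @^-1` (A `*` A) : set E).
  apply: finite_preimage; first by move=> ? ? _ _; exact: val_inj.
  by apply: finite_setX; exact: finite_Lambda.
apply: sub_finite_set => -[[x y] xy] /=.
have nn i : `|x ord0 i - y ord0 i| <= 1.
  move: xy => /eqP /= <-; rewrite (bigD1 i)//= lerDl sumr_ge0//.
have bnd (m : nat) (z : 'rV[int]_d) : Lambda d (m%:R : R) z <->
    forall i, - m%:Z <= z ord0 i <= m%:Z.
  rewrite LambdaE /= mem_cube; split => [/forallP//|h]; exact/forallP.
rewrite /edges_of /A /= !bnd => -[h|h]; split => i; have := h i; have := nn i;
  rewrite ler_norml; move: (x ord0 i) (y ord0 i) => a b; lia.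
Qed.

(** Tightness counts all edges at a box, whereas the orbit of [w] sees the translates of a single
    edge. Those starting at the points of the cube are distinct members of [edges_of]; indexing
    translates by their starting point costs [dl], and the cube has at least [n ^ d] points. *)
Lemma avg_edge_le (e : edge d) (dl : R) : 0 < dl ->
  exists N, forall n, (N <= n)%N -> forall G : edge d -> R,
  (forall e, 0 <= G e <= 1) ->
  avg n (fun x => G (edge_shift x e)) <=
  (n%:R ^+ d)^-1 * \sum_(e \in edges_of (Lambda d (n%:R : R))) G e + dl.
Proof.
move=> dl0; have [N hN] := @avg_shift R d (sval e).1 dl dl0.
(* The successor makes [n] positive, as [n ^ d] is inverted. *)
exists N.+1 => n Nn G G01.
pose F (z : 'rV[int]_d) := G (edge_shift (z - (sval e).1) e).
have := hN n (ltnW Nn) F 1.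
have -> : (fun x => F (x + (sval e).1)) = (fun x => G (edge_shift x e)).
  by apply/funext => x; rewrite /F addrK.
have F1 x : `|F x| <= 1 by rewrite ger0_norm; have /andP[] := G01 (edge_shift (x - (sval e).1) e).
move=> /(_ F1); rewrite mul1r => /ler_normlP[_].
rewrite lerBlDr addrC => /le_trans; apply; rewrite lerD2r.
pose E := edges_of (Lambda d (n%:R : R)).
have sumE : \sum_(x <- cube d n) F x <= \sum_(e \in E) G e.
  rewrite fsbig_finite; last exact: finite_edges_of.
  rewrite -(big_map (fun z => edge_shift (z - (sval e).1) e) xpredT G).
  apply: ler_sum_uniq => //.
  - rewrite map_inj_uniq ?uniq_cube// => x y /edge_shift_inj; exact: addIr.
  - exact: fset_uniq.
  - move=> _ /mapP[z zn ->]; rewrite in_fset_set; last exact: finite_edges_of.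
    apply/mem_set; left; rewrite /= addrC subrK LambdaE; exact: zn.
  - by move=> e'; have /andP[] := G01 e'.
apply: le_trans (ler_wpM2l _ sumE); last by rewrite invr_ge0 exprn_ge0.
rewrite /avg ler_wpM2r//.
  by apply: sumr_ge0 => z _; have /andP[] := G01 (edge_shift (z - (sval e).1) e).
have n0 : 0 < n%:R :> R by rewrite ltr0n (leq_trans _ Nn).
rewrite lef_pV2 ?posrE ?size_cube_gt0 ?exprn_gt0// size_cube natrX.
rewrite lerXn2r ?nnegrE ?ler0n// ler_nat -addnn; lia.
Qed.

Lemma tight_edge w (e : edge d) (eta : R) : tight w -> 0 < eta ->
  exists2 a : R, 0 < a & exists N, forall n, (N <= n)%N ->
  avg n (fun x => (~~ (a <= conductance e (tau x w) <= a^-1))%:R) <= eta.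
Proof.
move=> tw eta0.
have eta2 : 0 < eta / 2 by rewrite divr_gt0.
have H : \forall a \near (0 : R)^'+, (limn_esup (fun n : nat =>
    ((n%:R ^+ d)^-1 *
     \sum_(e \in edges_of (Lambda d (n%:R : R)))
       (\1_(~` `[a, 1 / a]%classic) (conductance e w) : R))%:E) < (eta / 2)%:E)%E.
  have nb : nbhs (0%E : \bar R) [set x | (x < (eta / 2)%:E)%E].
    by apply: open_nbhs_nbhs; split; [exact: open_ereal_lt_ereal|rewrite /= lte_fin].
  exact: (tw _ nb).
have H2 : \forall a \near (0 : R)^'+, 0 < a by exact: nbhs_right_gt.
have [a [/= /limn_esup_lt [N hN] a0]] := filter_ex (filterI H H2).
exists a => //; have [N' hN'] := @avg_edge_le e (eta / 2) eta2.
exists (maxn N N') => n; rewrite geq_max => /andP[Nn N'n].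
have := hN' n N'n (fun e => \1_(~` `[a, 1 / a]%classic) (conductance e w) : R).
have := hN n Nn; rewrite lte_fin => h1 h2.
pose G e := \1_(~` `[a, 1 / a]%classic) (conductance e w) : R.
have G01 e' : 0 <= G e' <= 1.
  by rewrite /G indicE; case: (_ \in _); rewrite lexx ler01.
have -> : (fun x => (~~ (a <= conductance e (tau x w) <= a^-1))%:R) =
    (fun x => G (edge_shift x e)).
  apply/funext => x; rewrite /G indicE in_setC; congr (~~ _)%:R.
  rewrite div1r; apply/idP/idP => [h|/set_mem]; last by rewrite /= in_itv.
  by apply/mem_set; rewrite /= in_itv.
apply: (le_trans (h2 G01)); rewrite [leRHS](splitr eta) lerD2r; exact: ltW.
Qed.

Lemma sum_half_le1 k : \sum_(i < k) 2^-1 ^+ i.+1 <= 1 :> R.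
Proof.
suff -> : \sum_(i < k) 2^-1 ^+ i.+1 = 1 - 2^-1 ^+ k :> R.
  by rewrite gerBl exprn_ge0.
elim: k => [|k IH]; first by rewrite big_ord0 expr0 subrr.
by rewrite big_ord_recr /= IH !exprS; set t := _ ^+ k; lra.
Qed.

(** The constraint of index [i] may fail with frequency [eta / 2 ^ (i + 1)]. The widths are thus
    chosen once for all [k], and a union bound over the first [k] constraints never exceeds [eta];
    only the threshold [N] depends on [k]. *)
Lemma tight_inK w (eta : R) : tight w -> 0 < eta ->
  exists2 eps, (forall i, 0 < eps i) & forall k, exists N, forall n, (N <= n)%N ->
  avg n (fun x => (~~ inK eps k (tau x w))%:R) <= eta.
Proof.
move=> tw eta0.
have /choice [eps heps] : forall i : nat, exists a : R, 0 < a /\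
    exists N, forall n, (N <= n)%N ->
    avg n (fun x => (~~ (if decode d i is Some e
        then a <= conductance e (tau x w) <= a^-1 else true))%:R)
      <= eta * 2^-1 ^+ i.+1.
  move=> i; have p0 : 0 < eta * 2^-1 ^+ i.+1 by rewrite mulr_gt0// exprn_gt0.
  case: (decode d i) => [e|].
    by have [a a0 ha] := tight_edge e tw p0; exists a.
  by exists 1; split => //; exists 0%N => n _; rewrite avg_cst ltW.
exists eps => [i|k]; first by have [] := heps i.
have /choice [N hN] : forall i, exists N, forall n, (N <= n)%N ->
    avg n (fun x => (~~ good eps i (tau x w))%:R) <= eta * 2^-1 ^+ i.+1.
  by move=> i; have [_] := heps i.
exists (\max_(i < k) N i) => n Nn.
apply: (@le_trans _ _ (\sum_(i < k) eta * 2^-1 ^+ i.+1)); last first.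
  by rewrite -mulr_sumr ler_piMr ?sum_half_le1// ltW.
apply: (@le_trans _ _ (\sum_(i < k) avg n (fun x => (~~ good eps i (tau x w))%:R))); last first.
  apply: ler_sum => i _; apply: hN; apply: leq_trans Nn.
  exact: (leq_bigmax (F := fun i : 'I_k => N i) i).
rewrite -(@avg_sum R d n k (fun i x => (~~ good eps i (tau x w))%:R)).
apply: le_avg => x; case: (boolP (inK eps k (tau x w))) => [_|] /=.
  exact: sumr_ge0.
rewrite negb_forall => /existsP[i hi].
by rewrite (bigD1 i)//= hi lerDl sumr_ge0.
Qed.

Lemma approx_Cloc w (f : config R d -> R) (M dl : R) : tight w ->
  continuous f -> (forall v, `|f v| <= M) -> 0 < dl ->
  exists h : config R d -> R, [/\ Cloc h, forall v, `|h v| <= M &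
    exists N, forall n, (N <= n)%N ->
    avg n (fun x => `|f (tau x w) - h (tau x w)|) <= dl].
Proof.
move=> tw cf fM dl0.
have M0 : 0 <= M by exact: le_trans (fM (tau 0 w)).
(* The error is at most [eta] on [inK eps k] and [2 M] off it, where the frequency is at most
   [eta]. *)
pose eta := dl / (1 + 2 * M).
have D0 : 0 < 1 + 2 * M by rewrite ltr_pwDl// mulr_ge0.
have eta0 : 0 < eta by rewrite divr_gt0.
have [eps eps0 heps] := tight_inK tw eta0.
have [k hk] := rho_approx eps0 cf eta0.
have [N hN] := heps k.
exists (fun v => f (rho k v) * chi eps k v).
have hM v : `|f (rho k v) * chi eps k v| <= M.
  have /andP[c0 c1] := chi_itv eps k v.
  by rewrite normrM (ger0_norm c0) -[M]mulr1 ler_pM.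
split; [exact: Cloc_rho_chi|exact: hM|exists N => n Nn].
apply: (@le_trans _ _ (avg n (fun x => eta + 2 * M * (~~ inK eps k (tau x w))%:R))).
  apply: le_avg => x; have [xK|xK] := boolP (inK eps k (tau x w)).
    by rewrite chi1// !mulr1 mulr0 addr0 hk.
  rewrite mulr1 (le_trans (ler_normB _ _))// mulr_natl mulr2n.
  by rewrite (le_trans (lerD (fM _) (hM _)))// lerDr ltW.
rewrite avgD avg_cst avgZ; have h := hN n Nn.
have -> : dl = eta * (1 + 2 * M) by rewrite /eta divfK// gt_eqF.
rewrite mulrDr mulr1 lerD2l.
by rewrite [leRHS]mulrC ler_wpM2l// mulr_ge0.
Qed.

(** The averages eventually stay within [dl] of the limit for a local approximant. That limit varies
    with [dl], which the Cauchy criterion permits. *)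
Lemma averaging_continuous w (f : config R d -> R) (M : R) : tight w ->
  averaging w -> continuous f -> (forall v, `|f v| <= M) ->
  cvg (avg n (fun x => f (tau x w)) @[n --> \oo]).
Proof.
move=> tw aw cf fM; apply/cauchy_cvgP/cauchy_exP => dl dl0.
have dl2 : 0 < dl / 2 by rewrite divr_gt0.
have [h [hloc _ [N hN]]] := approx_Cloc tw cf fM dl2.
have := aw h hloc; under eq_fun do rewrite mean_avg.
move=> /cvg_ex [l /cvgrPdist_lt/(_ _ dl2) [N' _ hN']].
exists l; exists (maxn N N') => // n /=; rewrite geq_max => /andP[Nn N'n].
have := hN' n N'n; have := hN n Nn => /= h1 h2.
rewrite /ball /=; apply: (@le_lt_trans _ _ (`|l - avg n (fun x => h (tau x w))|
   + `|avg n (fun x => h (tau x w)) - avg n (fun x => f (tau x w))|)).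
  by rewrite -[X in `|X|](subrKA (avg n (fun x => h (tau x w)))) ler_normD.
rewrite [ltRHS](splitr dl) ltr_leD// distrC -avgB.
exact: le_trans (ler_avg_norm _ _) h1.
Qed.

End approximation.

(** * Expectations of bounded measurable functions *)

Section bounded_measurable.
Context (d : measure_display) (T : measurableType d) (R : realType).
Implicit Types f g : T -> R.

(** This class is closed under products and integrable for every probability, so integrability
    conditions never have to be carried along. *)
Definition bm f : Prop :=
  measurable_fun setT f /\ exists M : R, forall x, `|f x| <= M.

Lemma bm_cst (a : R) : bm (fun=> a).
Proof. by split; [exact: measurable_cst|exists `|a|]. Qed.

Lemma bmD f g : bm f -> bm g -> bm (fun x => f x + g x).
Proof.
move=> [mf [M fM]] [mg [N gN]]; split; first exact: measurable_funD.
by exists (M + N) => x; rewrite (le_trans (ler_normD _ _))// lerD.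
Qed.

Lemma bmM f g : bm f -> bm g -> bm (fun x => f x * g x).
Proof.
move=> [mf [M fM]] [mg [N gN]]; split; first exact: measurable_funM.
by exists (M * N) => x; rewrite normrM ler_pM.
Qed.

Lemma bmZ (a : R) f : bm f -> bm (fun x => a * f x).
Proof. by move=> ?; apply: bmM => //; exact: bm_cst. Qed.

Lemma bmN f : bm f -> bm (fun x => - f x).
Proof.
move=> /(bmZ (-1)); rewrite (_ : (fun x => -1 * f x) = (fun x => - f x))//.
by apply/funext => x; rewrite mulN1r.
Qed.

Lemma bmB f g : bm f -> bm g -> bm (fun x => f x - g x).
Proof. by move=> bf bg; apply: bmD => //; exact: bmN. Qed.

Lemma bm_norm f : bm f -> bm (fun x => `|f x|).
Proof.
move=> [mf [M fM]]; split; first exact: measurableT_comp.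
by exists M => x; rewrite normr_id.
Qed.

Lemma bm_sum (I : Type) (s : seq I) (F : I -> T -> R) :
  (forall i, bm (F i)) -> bm (fun x => \sum_(i <- s) F i x).
Proof.
move=> bF; elim: s => [|i s IH].
  by under eq_fun do rewrite big_nil; exact: bm_cst.
by under eq_fun do rewrite big_cons; exact: bmD.
Qed.

Lemma bm_indic (A : set T) : measurable A -> bm (\1_A : T -> R).
Proof.
move=> mA; split; first exact: measurable_indic.
by exists 1 => x; rewrite indicE; case: (_ \in _); rewrite ?normr0 ?normr1 ?ler01 ?lexx.
Qed.

End bounded_measurable.

Section expectation_bounded.
Context (d : measure_display) (T : measurableType d) (R : realType)
  (P : probability T R).
Implicit Types f g : T -> R.

Definition Ex f : R := \int[P]_x f x.

Lemma bm_integrable f : bm f -> P.-integrable setT (EFin \o f).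
Proof.
move=> [mf [M fM]]; apply: measurable_bounded_integrable => //.
  by rewrite (le_lt_trans (probability_le1 _ _))// ltry.
exists M; split; first exact: num_real.
by move=> N MN x _; rewrite /= (le_trans (fM x))// ltW.
Qed.

Lemma EFin_Ex f : bm f -> (Ex f)%:E = (\int[P]_x (f x)%:E)%E.
Proof.
move=> bf; rewrite /Ex /Rintegral fineK//.
exact: integrable_fin_num (bm_integrable bf).
Qed.

Lemma ExD f g : bm f -> bm g -> Ex (fun x => f x + g x) = Ex f + Ex g.
Proof. by move=> bf bg; apply: RintegralD => //; exact: bm_integrable. Qed.

Lemma ExZ (a : R) f : bm f -> Ex (fun x => a * f x) = a * Ex f.
Proof. by move=> bf; apply: RintegralZl => //; exact: bm_integrable. Qed.

Lemma Ex_cst (a : R) : Ex (fun=> a) = a.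
Proof. by rewrite /Ex Rintegral_cst//= [X in fine X](probability_setT P) mulr1. Qed.

Lemma ExN f : bm f -> Ex (fun x => - f x) = - Ex f.
Proof.
by move=> bf; rewrite -mulN1r -ExZ//; congr Ex; apply/funext => x; rewrite mulN1r.
Qed.

Lemma ExB f g : bm f -> bm g -> Ex (fun x => f x - g x) = Ex f - Ex g.
Proof. by move=> bf bg; rewrite ExD ?ExN//; exact: bmN. Qed.

Lemma le_Ex f g : bm f -> bm g -> (forall x, f x <= g x) -> Ex f <= Ex g.
Proof. by move=> bf bg fg; apply: le_Rintegral => //; exact: bm_integrable. Qed.

Lemma Ex_ge0 f : (forall x, 0 <= f x) -> 0 <= Ex f.
Proof. by move=> f0; apply: Rintegral_ge0. Qed.

Lemma Ex_norm f : bm f -> `|Ex f| <= Ex (fun x => `|f x|).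
Proof. by move=> bf; apply: le_normr_Rintegral => //; exact: bm_integrable. Qed.

Lemma Ex_sum (I : Type) (s : seq I) (F : I -> T -> R) :
  (forall i, bm (F i)) -> Ex (fun x => \sum_(i <- s) F i x) = \sum_(i <- s) Ex (F i).
Proof.
move=> bF; elim: s => [|i s IH].
  by rewrite big_nil; under eq_fun do rewrite big_nil; exact: Ex_cst.
rewrite big_cons -IH -ExD//; first by under eq_fun do rewrite big_cons.
exact: bm_sum.
Qed.

Lemma Ex_indic (A : set T) : measurable A -> Ex (\1_A) = fine (P A).
Proof. by move=> mA; rewrite /Ex /Rintegral integral_indic// setIT. Qed.

(** Bounded convergence: the dominating constant is integrable for a probability. *)
Lemma Ex_cvg (f_ : nat -> T -> R) f (M : R) : (forall n, measurable_fun setT (f_ n)) ->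
  measurable_fun setT f -> (forall n x, `|f_ n x| <= M) ->
  (forall x, f_ n x @[n --> \oo] --> f x) -> Ex (f_ n) @[n --> \oo] --> Ex f.
Proof.
move=> mf_ mf fM cf.
have bf_ n : bm (f_ n) by split; [exact: mf_|exists M => x; exact: fM].
have bf : bm f.
  split => //; exists M => x.
  have c : `|f_ n x| @[n --> \oo] --> `|f x| by apply: cvg_norm; exact: cf.
  have ic : cvg (`|f_ n x| @[n --> \oo]) by apply/cvg_ex; exists `|f x|.
  rewrite -(cvg_lim (@Rhausdorff R) c); apply: limr_le => //.
  by apply: nearW => n; exact: fM.
have : (\int[P]_x (f_ n x)%:E)%E @[n --> \oo] --> (\int[P]_x (f x)%:E)%E.
  apply: (@dominated_cvg _ _ _ P setT measurableT (fun n x => (f_ n x)%:E)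
    (fun x => (f x)%:E) (fun=> M%:E)).
  - by move=> n; exact/measurable_EFinP.
  - by move=> x _; apply: cvg_EFin; [exact: nearW|exact: cf].
  - by [].
  - exact: (bm_integrable (bm_cst T M)).
  - by move=> n x _; rewrite /= lee_fin; exact: fM.
rewrite -EFin_Ex//; under eq_fun do rewrite -EFin_Ex//.
exact: fine_cvg.
Qed.

End expectation_bounded.

(** * Daniell-Stone representation *)

Section daniell.
Context (dsp : measure_display) (T : measurableType dsp) (R : realType).
Variables (C : set (T -> R)) (L : (T -> R) -> R).
Hypothesis C_bm : forall f, C f -> bm f.
Hypothesis C_cst : forall a : R, C (fun=> a).
Hypothesis C_add : forall f g, C f -> C g -> C (fun x => f x + g x).
Hypothesis C_mul : forall f g, C f -> C g -> C (fun x => f x * g x).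
Hypothesis C_pos : forall f, C f -> C (fun x => Num.max 0 (f x)).
Hypothesis L_add : forall f g, C f -> C g -> L (fun x => f x + g x) = L f + L g.
Hypothesis L_scale : forall (a : R) f, C f -> L (fun x => a * f x) = a * L f.
Hypothesis L_ge0 : forall f, C f -> (forall x, 0 <= f x) -> 0 <= L f.
Hypothesis L_one : L (fun=> 1) = 1.
Hypothesis L_cont : forall f : nat -> T -> R, (forall k, C (f k)) ->
  (forall k x, f k.+1 x <= f k x) -> (forall x, f k x @[k --> \oo] --> 0) ->
  L (f k) @[k --> \oo] --> 0.
Hypothesis C_gen : measurable `<=`
  <<s [set A | exists2 h, C h /\ (forall x, 0 <= h x) & A = [set x | 0 < h x]] >>.

Let C_scale (a : R) f : C f -> C (fun x => a * f x).
Proof. by move=> Cf; apply: C_mul. Qed.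

Let C_sub f g : C f -> C g -> C (fun x => f x - g x).
Proof.
move=> Cf /(C_scale (-1)) Cg; have := C_add Cf Cg.
by rewrite (_ : (fun x => f x + -1 * g x) = (fun x => f x - g x))//;
  apply/funext => x; rewrite mulN1r.
Qed.

Let L_sub f g : C f -> C g -> L (fun x => f x - g x) = L f - L g.
Proof.
move=> Cf Cg; rewrite -mulN1r -L_scale// -L_add//; last exact: C_scale.
by congr L; apply/funext => x; rewrite mulN1r.
Qed.

Let L_le f g : C f -> C g -> (forall x, f x <= g x) -> L f <= L g.
Proof.
move=> Cf Cg fg; rewrite -subr_ge0 -L_sub//; apply: L_ge0; first exact: C_sub.
by move=> x; rewrite subr_ge0.
Qed.

Let L_cst (a : R) : L (fun=> a) = a.
Proof.
rewrite -[RHS]mulr1 -L_one -L_scale//; congr L.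
by apply/funext => x; rewrite mulr1.
Qed.

Let C_sum (s : nat) (F : nat -> T -> R) : (forall i, C (F i)) ->
  C (fun x => \sum_(i < s) F i x).
Proof.
move=> CF; elim: s => [|s IH].
  by under eq_fun do rewrite big_ord0; exact: C_cst.
by under eq_fun do rewrite big_ord_recr; exact: C_add.
Qed.

Let L_sum (s : nat) (F : nat -> T -> R) : (forall i, C (F i)) ->
  L (fun x => \sum_(i < s) F i x) = \sum_(i < s) L (F i).
Proof.
move=> CF; elim: s => [|s IH].
  by rewrite big_ord0; under eq_fun do rewrite big_ord0; exact: L_cst.
rewrite big_ord_recr/= -IH -L_add//; first by under eq_fun do rewrite big_ord_recr.
exact: C_sum.
Qed.

(* Covering by increasing sequences instead of series: countable subadditivity
   then needs no double sums, and the cover of [A `&` [set x | 0 < h x]] in the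
   Caratheodory condition is a diagonal product. *)
Definition covered (A : set T) (c : R) : Prop := exists g : nat -> T -> R,
  [/\ forall k, C (g k), forall k x, 0 <= g k x, forall k x, g k x <= g k.+1 x,
    forall k, L (g k) <= c & forall x, A x -> exists k, 1 <= g k x].

Let mono (g : nat -> T -> R) : (forall k x, g k x <= g k.+1 x) ->
  forall j k x, (j <= k)%N -> g j x <= g k x.
Proof.
move=> gS j k x jk; rewrite -(subnKC jk); elim: (k - j)%N => [|i IH].
  by rewrite addn0.
by rewrite addnS (le_trans IH).
Qed.

Let covered1 A : covered A 1.
Proof.
by exists (fun _ _ => 1); split => //; [rewrite L_one|move=> x _; exists 0%N].
Qed.

Let covered_ge0 A c : covered A c -> 0 <= c.
Proof. by move=> [g [Cg g0 _ Lg _]]; apply: le_trans (Lg 0%N); exact: L_ge0. Qed.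

Let coveredS A B c c' : A `<=` B -> c <= c' -> covered B c -> covered A c'.
Proof.
move=> AB cc' [g [? ? ? Lg gB]]; exists g; split => //.
  by move=> k; rewrite (le_trans (Lg k)).
by move=> x /AB; exact: gB.
Qed.

(** The outer measure is real-valued because the constant function 1 covers every set. *)
Let m (A : set T) : R := inf [set c | covered A c].

Let m_has_inf A : has_inf [set c | covered A c].
Proof.
split; first by exists 1; exact: covered1.
by exists 0 => c /covered_ge0.
Qed.

Let m_le A c : covered A c -> m A <= c.
Proof. by move=> h; apply: ge_inf => //; exact: (m_has_inf A).2. Qed.

Let m_ge A c : (forall c', covered A c' -> c <= c') -> c <= m A.
Proof.
by move=> h; apply: lb_le_inf; [exact: (m_has_inf A).1|move=> c' /h].
Qed.

Let m_cov A dl : 0 < dl -> covered A (m A + dl).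
Proof.
move=> dl0; have [c /= cA cm] := inf_adherent dl0 (m_has_inf A).
by apply: coveredS cA => //; exact: ltW.
Qed.

Let mu (A : set T) : \bar R := (m A)%:E.

Let mu0 : mu set0 = 0%E.
Proof.
congr EFin; apply/eqP; rewrite eq_le; apply/andP; split.
  by apply: m_le; exists (fun _ _ => 0); split => // k; rewrite L_cst.
by apply: m_ge => c /covered_ge0.
Qed.

Let mu_ge0 A : (0 <= mu A)%E.
Proof. by rewrite lee_fin; apply: m_ge => c /covered_ge0. Qed.

Let mu_le : {homo mu : A B / A `<=` B >-> (A <= B)%E}.
Proof.
by move=> A B AB; rewrite lee_fin; apply: m_ge => c cB; apply: m_le; exact: coveredS cB.
Qed.

Let mu_sub : sigma_subadditive mu.
Proof.
move=> F; have [s_oo|] := eqVneq (\sum_(i <oo) mu (F i))%E +oo%E.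
  by rewrite s_oo leey.
have s0 : (0 <= \sum_(i <oo) mu (F i))%E by apply: nneseries_ge0.
case E : (\sum_(i <oo) mu (F i))%E s0 => [s| |]// s0 _.
rewrite lee_fin; apply/ler_addgt0Pr => dl dl0; apply: m_le.
have /choice [g hg] : forall n, exists g : nat -> T -> R,
    [/\ forall k, C (g k), forall k x, 0 <= g k x, forall k x, g k x <= g k.+1 x,
      forall k, L (g k) <= m (F n) + dl * 2^-1 ^+ n.+1 &
      forall x, F n x -> exists k, 1 <= g k x].
  by move=> n; apply: m_cov; rewrite mulr_gt0// exprn_gt0.
have Cg n k : C (g n k) by have [] := hg n.
have g0 n k x : 0 <= g n k x by have [_ + _ _ _] := hg n; apply.
have gS n k x : g n k x <= g n k.+1 x by have [_ _ + _ _] := hg n; apply.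
have Lg n k : L (g n k) <= m (F n) + dl * 2^-1 ^+ n.+1 by have [_ _ _ + _] := hg n; apply.
(* Diagonal sums: at stage [k] the first [k + 1] covers are taken at their own stage [k], so that
   [L] is applied to finite sums only. *)
exists (fun k x => \sum_(n < k.+1) g n k x); split.
- by move=> k; apply: (@C_sum k.+1 (fun n => g n k)).
- by move=> k x; apply: sumr_ge0.
- by move=> k x; rewrite [leRHS]big_ord_recr/= ler_wpDr// ler_sum.
- move=> k; rewrite (@L_sum k.+1 (fun n => g n k))//.
  apply: (@le_trans _ _ (\sum_(n < k.+1) (m (F n) + dl * 2^-1 ^+ n.+1))).
    by apply: ler_sum => n _.
  rewrite big_split/= lerD//; last by rewrite -mulr_sumr ler_piMr ?sum_half_le1// ltW.
  rewrite -lee_fin -E -sumEFin.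
  rewrite -(big_mkord xpredT (fun n => mu (F n))).
  by apply: nneseries_lim_ge => *; exact: mu_ge0.
- move=> x [n _ Fx]; have [_ _ _ _ /(_ x Fx) [k hk]] := hg n.
  exists (maxn k n).
  have nk : (n < (maxn k n).+1)%N by rewrite ltnS leq_maxr.
  rewrite (bigD1 (Ordinal nk))//= ler_wpDr ?sumr_ge0//.
  apply: (le_trans hk); apply: mono => //; exact: leq_maxl.
Qed.

Let om : {outer_measure set T -> \bar R} :=
  HB.pack mu (isOuterMeasure.Build R T mu mu0 mu_ge0 mu_le mu_sub).

(** A cover [g] of [X] is split by cutoffs [phi] increasing to the indicator of positivity of [h]:
    the products [g k * phi k] cover the part of [X] where [h > 0]. With a fixed [J], the remainders
    [g k * (1 - phi J)] cover the other part, since [phi J] vanishes where [h] does. *)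
Let cara_pos h : C h -> (forall x, 0 <= h x) ->
  caratheodory_measurable om [set x | 0 < h x].
Proof.
move=> Ch h0; apply: le_caratheodory_measurable => X /=.
rewrite /mu -EFinD lee_fin; apply/ler_addgt0Pr => dl dl0.
apply: (@le_trans _ _ (m X + dl / 2 + dl / 2)); last first.
  by rewrite -addrA -splitr.
have dl2 : 0 < dl / 2 by rewrite divr_gt0.
have [g [Cg g0 gS Lg gX]] := m_cov X dl2.
move: (m X + dl / 2) Lg => c Lg.
(* [phi j] is [min 1 (j h)], expressed by the positive part under which [C] is closed. *)
pose phi (j : nat) x : R := 1 - Num.max 0 (1 - j%:R * h x).
have Cphi j : C (phi j) by apply: C_sub => //; apply: C_pos; apply: C_sub => //; exact: C_scale.
have phi0 j x : 0 <= phi j x.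
  by rewrite subr_ge0 ge_max ler01 gerBl mulr_ge0.
have phi1 j x : phi j x <= 1 by rewrite gerBl le_max lexx.
have phiS j x : phi j x <= phi j.+1 x.
  by rewrite lerB// ge_max le_max lexx/= le_max lerB ?orbT// ler_wpM2r// ler_nat.
pose G k x := g k x * phi k x.
have CG k : C (G k) by exact: C_mul.
have GS k x : G k x <= G k.+1 x by rewrite ler_pM.
have LG k : L (G k) <= c.
  by rewrite (le_trans _ (Lg k))// L_le// => x; rewrite ler_piMr.
pose s := sup [set L (G k) | k in [set: nat]].
have hs : has_sup [set L (G k) | k in [set: nat]].
  by split; [exists (L (G 0%N)), 0%N|exists c => _ [k _ <-]].
(* From the stage [J] on, at most [dl / 2] of the supremum [s] is missing. *)
have [_ [J _ <-] hJ] := sup_adherent dl2 hs.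
have cov1 : covered (X `&` [set x | 0 < h x]) s.
  exists G; split => //.
  - by move=> k x; rewrite mulr_ge0.
  - by move=> k; apply: ub_le_sup; [exact: hs.2|exists k].
  - move=> x [Xx /= hx]; have [k hk] := gX x Xx.
    have [j hj] : exists j : nat, 1 <= j%:R * h x.
      have [N _ hN] : \forall n \near \oo, (h x)^-1 <= n%:R by exact: nbhs_infty_ger.
      exists N; rewrite -ler_pdivrMr// div1r; exact: (hN N (leqnn N)).
    exists (maxn k j); rewrite /G.
    have -> : phi (maxn k j) x = 1.
      rewrite /phi; have -> : Num.max 0 (1 - (maxn k j)%:R * h x) = 0; last by rewrite subr0.
      apply/max_idPl; rewrite subr_le0 (le_trans hj)// ler_wpM2r//.
      by rewrite ler_nat leq_maxr.
    by rewrite mulr1 (le_trans hk)//; apply: mono => //; exact: leq_maxl.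
have cov2 : covered (X `&` ~` [set x | 0 < h x]) (c - s + dl / 2).
  pose H k x := g k x - g k x * phi J x.
  have CH k : C (H k) by apply: C_sub => //; exact: C_mul.
  have HE k x : H k x = g k x * (1 - phi J x) by rewrite mulrBr mulr1.
  have HS k x : H k x <= H k.+1 x by rewrite !HE ler_wpM2r// subr_ge0.
  exists H; split => //.
  - by move=> k x; rewrite HE mulr_ge0// subr_ge0.
  (* Passing to [K >= J] can only increase [H], and it makes the subtracted term at least [L (G J)],
     which exceeds [s - dl / 2]. *)
  - move=> k; pose K := maxn k J.
    apply: (@le_trans _ _ (L (H K))).
      by apply: L_le => // x; apply: mono => //; exact: leq_maxl.
    rewrite L_sub//; last exact: C_mul.
    have h1 := Lg K.
    have h2 : L (G J) <= L (fun x => g K x * phi J x).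
      apply: L_le => // [|x]; first exact: C_mul.
      by rewrite ler_wpM2r//; apply: mono => //; exact: leq_maxr.
    have h3 := hJ; rewrite -/s in h3; lra.
  - move=> x [Xx /= /negP]; rewrite -leNgt => hx.
    have HE0 k : H k x = g k x.
      have hx0 : h x = 0 by apply/eqP; rewrite eq_le hx h0.
      rewrite HE /phi hx0 mulr0 subr0.
      by have -> : Num.max 0 1 = 1 :> R; [exact/max_idPr|rewrite subrr subr0 mulr1].
    by have [k hk] := gX x Xx; exists k; rewrite HE0.
apply: (@le_trans _ _ (s + (c - s + dl / 2))); last by lra.
by rewrite lerD// m_le.
Qed.

Let meas_cara : measurable `<=` caratheodory_measurable om.
Proof.
apply: (subset_trans C_gen); apply: smallest_sub.
  split.
  - exact: caratheodory_measurable_set0.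
  - by move=> A mA; rewrite setTD; exact: caratheodory_measurable_setC.
  - exact: caratheodory_measurable_bigcup.
by move=> _ [h [Ch h0] ->]; exact: cara_pos.
Qed.

Let mu_sigma : semi_sigma_additive mu.
Proof.
move=> F mF tF mUF.
apply: (@caratheodory_measure_sigma_additive R T om) => //.
  by move=> i; exact: meas_cara.
exact: meas_cara.
Qed.

(** Continuity of [L] along decreasing sequences enters here. If [g] covers the whole space, the
    positive parts of [1 - g k] decrease to 0, so [L (g k)] comes arbitrarily close to 1 and no
    cover is cheaper than 1. *)
Let muT : mu setT = 1%E.
Proof.
congr EFin; apply/eqP; rewrite eq_le m_le//=.
apply: m_ge => c [g [Cg g0 gS Lg gT]].
pose r k x := Num.max 0 (1 - g k x).
have Cr k : C (r k) by apply: C_pos; exact: C_sub.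
have : L (r k) @[k --> \oo] --> 0.
  apply: L_cont => //.
    by move=> k x; rewrite /r ge_max le_max lexx/= le_max lerB ?orbT.
  move=> x; have [k hk] := gT x I.
  apply: cvg_near_cst; exists k => // j /= kj; apply/max_idPl.
  by rewrite subr_le0 (le_trans hk)//; exact: mono.
move=> Lr; apply/ler_addgt0Pr => dl dl0.
move/cvgr0Pnorm_lt/(_ _ dl0) : Lr => [N _ /(_ N (leqnn _))] /= /(le_lt_trans (ler_norm _)) hN.
have : L (fun=> 1) <= L (fun x => g N x + r N x).
  apply: L_le => //; first exact: C_add.
  by move=> x; rewrite /r -lerBlDl le_max lexx orbT.
by rewrite L_one L_add// => /le_trans; apply; rewrite lerD// ltW.
Qed.

Let P0 : {measure set T -> \bar R} :=
  HB.pack mu (isMeasure.Build _ T R mu mu0 mu_ge0 mu_sigma).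
Let P : probability T R :=
  HB.pack mu P0 (Measure_isProbability.Build _ T R P0 muT).

(** A layer-cake sum with [N + 1] levels. The slice [p i] clips [t - i] to [[0, 1]] and is itself a
    cover of [E i], so the measure of [E i] is at most [L (p i)]; the slices add up to at most [t].
    Rounding loses one level, that is [1 / (N + 1) <= dl]. *)
Let Ex_le_L f : C f -> (forall x, 0 <= f x <= 1) -> Ex P f <= L f.
Proof.
move=> Cf f01; apply/ler_addgt0Pr => dl dl0.
have [N _ /(_ N.+1 (leqnSn _)) hN] : \forall n \near \oo, dl^-1 <= n%:R by exact: nbhs_infty_ger.
have {hN}N0 : 1 <= dl * N.+1%:R by rewrite mulrC -ler_pdivrMr// div1r.
pose t x := N.+1%:R * f x.
pose q (i : nat) x := Num.max 0 (t x - i%:R).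
have Ct : C t by exact: C_scale.
have Cq i : C (q i) by apply: C_pos; apply: C_sub.
pose p i x := q i x - q i.+1 x.
have Cp i : C (p i) by exact: C_sub.
pose E i := [set x | 1 <= p i x].
have mE i : measurable (E i).
  have [mp _] := C_bm (Cp i).
  rewrite (_ : E i = p i @^-1` `[1, +oo[); first by rewrite -[X in measurable X]setTI; exact: mp.
  by apply/seteqP; split => x /=; rewrite in_itv/= andbT.
have pS i x : p i x = if t x <= i%:R then 0 else if t x <= i.+1%:R then t x - i%:R else 1.
  rewrite /p /q /Num.max -natr1 !subr_gt0 !ltNge.
  by case: (leP (t x) i%:R) => h1; case: (leP (t x) (i%:R + 1)) => h2 /=; lra.
have p01 i x : 0 <= p i x <= 1.
  rewrite pS; case: (leP (t x) i%:R) => h1; first by rewrite lexx ler01.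
  rewrite -natr1; case: (leP (t x) (i%:R + 1)) => h2; lra.
have PE i : Ex P (\1_(E i)) <= L (p i).
  rewrite Ex_indic// -[fine _]/(m (E i)); apply: m_le.
  exists (fun=> p i); split => [//|k x|//|//|x xE]; first by case/andP: (p01 i x).
  by exists 0%N.
(* The slice [p i.+1] is nonzero only where [t > i + 1], and there [p i] is 1; hence it lies below
   the indicator of [E i]. These slices telescope to [q 1], which is at least [t - 1]. *)
have dom x : t x <= 1 + \sum_(i < N.+1) \1_(E i) x.
  have tel : \sum_(i < N.+1) p i.+1 x = q 1%N x - q N.+2 x.
    rewrite /p -(big_mkord xpredT (fun i => q i.+1 x - q i.+2 x)).
    under eq_bigr do rewrite -opprB; rewrite sumrN.
    by rewrite (telescope_sumr (fun i => q i.+1 x))// opprB.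
  have q0 : q N.+2 x = 0.
    apply/max_idPl; rewrite subr_le0 /t -natr1.
    have /andP[_ f1] := f01 x.
    have : N.+1%:R * f x <= N.+1%:R by rewrite ler_piMr.
    lra.
  have q1 : t x - 1 <= q 1%N x by rewrite /q le_max lexx orbT.
  rewrite q0 subr0 in tel.
  rewrite addrC -lerBlDr (le_trans q1)// -tel; apply: ler_sum => i _.
  rewrite indicE; case: (boolP (x \in E i)) => [_|/negP xE].
    by case/andP: (p01 i.+1 x).
  have : ~~ (1 <= p i x) by apply/negP => h; apply: xE; exact/mem_set.
  rewrite !pS; case: (leP (t x) i.+1%:R) => h1; first by rewrite lexx.
  have -> : (t x <= i%:R) = false by rewrite leNgt (lt_trans _ h1) ?ltr_nat.
  by rewrite lexx.
have bE i : bm (\1_(E i) : T -> R) by exact: bm_indic.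
pose S x : R := \sum_(i < N.+1) \1_(E i) x.
have bS : bm S by apply: (@bm_sum _ _ _ _ _ (fun i : 'I_N.+1 => \1_(E i) : T -> R)).
have ES : Ex P S = \sum_(i < N.+1) Ex P (\1_(E i)).
  exact: (@Ex_sum _ _ _ P _ _ (fun i : 'I_N.+1 => \1_(E i) : T -> R)).
have := @le_Ex _ _ _ P _ _ (C_bm Ct) (bmD (bm_cst T 1) bS) dom.
rewrite ExZ ?ExD ?Ex_cst ?ES//; [|exact: bm_cst|exact: C_bm].
have : \sum_(i < N.+1) Ex P (\1_(E i)) <= N.+1%:R * L f.
  apply: (@le_trans _ _ (\sum_(i < N.+1) L (p i))); first exact: ler_sum.
  rewrite -L_sum// -L_scale//; apply: L_le => //; first exact: C_sum.
  move=> x; rewrite /p -(big_mkord xpredT (fun i => q i x - q i.+1 x)).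
  under eq_bigr do rewrite -opprB; rewrite sumrN.
  rewrite (telescope_sumr (fun i => q i x))// opprB /q subr0.
  rewrite -/(t x) lerBlDr; have /andP[f0 _] := f01 x.
  have -> : Num.max 0 (t x) = t x by apply/max_idPr; rewrite mulr_ge0.
  by rewrite lerDl le_max lexx.
have : 0 < N.+1%:R :> R by [].
move: N.+1%:R N0 => n N0 n0 h1 h2.
rewrite -(ler_pM2l n0); lra.
Qed.

Lemma daniell_stone : exists Q : probability T R,
  forall f, C f -> (\int[Q]_x (f x)%:E)%E = (L f)%:E.
Proof.
exists P => f Cf; rewrite -EFin_Ex; last exact: C_bm.
congr EFin.
(* The inequality for [1 - g] is the reverse inequality for [g]. *)
have eq01 g : C g -> (forall x, 0 <= g x <= 1) -> Ex P g = L g.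
  move=> Cg g01; apply/eqP; rewrite eq_le Ex_le_L//=.
  have g1 x : 0 <= 1 - g x <= 1.
    by have /andP[? ?] := g01 x; apply/andP; split; lra.
  have := Ex_le_L (C_sub (C_cst 1) Cg) g1.
  rewrite ExB; [|exact: bm_cst|exact: C_bm].
  by rewrite L_sub// Ex_cst L_one; lra.
have [_ [M fM]] := C_bm Cf.
(* An affine change of variable brings [f] into [[0, 1]]; the added 1 makes the divisor [2 K]
   positive. *)
pose K := `|M| + 1.
have K0 : 0 < K by rewrite ltr_wpDl.
pose g x := (2 * K)^-1 * (f x + K).
have Cg : C g by apply: C_scale; exact: C_add.
have fE : f = fun x => 2 * K * g x - K.
  apply/funext => x; rewrite /g mulrA mulfV ?mul1r ?addrK//.
  by rewrite gt_eqF// mulr_gt0.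
have g01 x : 0 <= g x <= 1.
  have : `|f x| <= K by rewrite (le_trans (fM x))// (le_trans (ler_norm M))// lerDl.
  rewrite ler_norml => /andP[h1 h2].
  rewrite /g ler_pdivrMl ?mulr_gt0//; apply/andP; split; last lra.
  by apply: mulr_ge0; [rewrite invr_ge0 mulr_ge0// ltW|lra].
have bg := C_bm Cg.
rewrite fE ExB; [|exact: bmZ|exact: bm_cst].
rewrite L_sub//; last exact: C_scale.
by rewrite ExZ// Ex_cst L_scale// L_cst eq01.
Qed.

End daniell.

(** * Borel functions of configurations *)

Section config_measurability.
Variables (R : realType) (d : nat).
Implicit Types (e : edge d) (w : config R d) (f : config R d -> R).

Lemma measurable_conductance e :
  measurable_fun setT (conductance e : config R d -> R).
Proof.
by move=> _ B mB; rewrite setTI; apply: sub_sigma_algebra; exists e, B.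
Qed.

Lemma measurable_tau x : measurable_fun setT (@tau R d x).
Proof.
apply: (@measurability _ _ _ _ setT (@tau R d x) (@cylinders R d)) => //.
move=> _ [_ [e [B mB ->]] <-]; rewrite setTI.
by apply: sub_sigma_algebra; exists (edge_shift x e), B.
Qed.

Section discretization.
Variable k : nat.

(** The upper end of a mesh cell is taken, since the lower end of cell 0 would not be positive. *)
Definition grid (s : seq nat) e : R :=
  if (idx e < k)%N then (nth 0%N s (idx e)).+1%:R / k.+1%:R else 1.

Lemma grid_gt0 s e : 0 < grid s e.
Proof. by rewrite /grid; case: ifP => // _; rewrite divr_gt0. Qed.

Lemma grid_sym s e : grid s (edge_rev e) = grid s e.
Proof. by rewrite /grid idx_rev. Qed.

Definition recon (s : seq nat) : config R d := mkconfig (grid_gt0 s) (grid_sym s).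

Definition level w (i : nat) : nat :=
  if decode d i is Some e then Num.truncn (k.+1%:R * conductance e w) else 0%N.

Definition levels w : seq nat := mkseq (level w) k.

Lemma measurable_level i n : measurable [set w | level w i = n].
Proof.
rewrite /level; case: (decode d i) => [e|]; last first.
  case: (eqVneq 0%N n) => [<-|n0].
    by rewrite (_ : [set _ | _] = setT)//; apply/seteqP; split.
  rewrite (_ : [set _ | _] = set0)//; apply/seteqP; split => // w /= h.
  by rewrite h eqxx in n0.
rewrite (_ : [set _ | _] =
    conductance e @^-1` `[n%:R / k.+1%:R, n.+1%:R / k.+1%:R[).
  by rewrite -[X in measurable X]setTI; exact: measurable_conductance.
have k0 : 0 < k.+1%:R :> R by [].
apply/seteqP; split => w /=; rewrite in_itv/= ler_pdivrMr// ltr_pdivlMr// mulrC.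
  by move=> /eqP; rewrite truncn_eq// mulr_ge0// ltW// conductance_gt0.
by rewrite -truncn_eq ?mulr_ge0// ?ltW ?conductance_gt0// => /eqP.
Qed.

(** Discretized configurations are indexed by [k]-tuples of naturals, of which there are countably
    many; hence no regularity of [f] enters. *)
Lemma measurable_recon f : measurable_fun setT (fun w => f (recon (levels w))).
Proof.
move=> _ B mB; rewrite setTI.
rewrite (_ : _ @^-1` B = \bigcup_(s : k.-tuple nat)
   ([set w | levels w = s] `&` [set w | B (f (recon s))])); last first.
  apply/seteqP; split => [w /= h|w [s _ [/= ->]]//].
  have sz : size (levels w) == k by rewrite size_mkseq.
  by exists (Tuple sz).
apply: countable_bigcupT_measurable; first exact: countableP.
move=> s; apply: measurableI; last first.
  have [h|h] := pselect (B (f (recon s))).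
    by rewrite (_ : [set _ | _] = setT)//; apply/seteqP; split.
  by rewrite (_ : [set _ | _] = set0)//; apply/seteqP; split.
rewrite (_ : [set _ | _] = \bigcap_(i : nat)
    (if (i < k)%N then [set w | level w i = nth 0%N s i] else setT)); last first.
  apply/seteqP; split => w /= h.
    move=> i _; case: ifP => // ik /=; rewrite -h nth_mkseq//.
  apply: (@eq_from_nth _ 0%N); first by rewrite size_mkseq size_tuple.
  move=> i; rewrite size_mkseq => ik; rewrite nth_mkseq//.
  by have := h i I; rewrite ik.
apply: bigcapT_measurable => i; case: ifP => // ik.
exact: measurable_level.
Qed.

Lemma recon_near w e : (idx e < k)%N ->
  `|conductance e (recon (levels w)) - conductance e w| <= k.+1%:R^-1.
Proof.
move=> ek; rewrite conductance_mkconfig /grid ek nth_mkseq// /level.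
have E : conductance (odflt e (decode d (idx e))) w = conductance e w.
  by have [->|->] := idxP e; rewrite codeK//= conductance_rev.
case D : (decode d (idx e)) E => [e'|] /= E; last first.
  by have := D; have [->|->] := idxP e; rewrite codeK.
rewrite E; set c := conductance e w.
have c0 : 0 <= c by rewrite ltW// conductance_gt0.
have k0 : 0 < k.+1%:R :> R by [].
have /andP[h1 h2] := truncn_itv (mulr_ge0 (ltW k0) c0).
set n := Num.truncn _ in h1 h2 *.
rewrite ger0_norm; last by rewrite subr_ge0 ler_pdivlMr// mulrC ltW.
rewrite lerBlDl -ler_pdivlMr ?invr_gt0// invrK mulrDl mulVf ?gt_eqF//.
by rewrite -natr1 lerD2r mulrC.
Qed.

End discretization.

(** The sigma-algebra is generated by cylinders, not by open sets, so continuity does not give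
    measurability outright. Discretizing more and more edges with mesh [1 / (k + 1)] exhibits [f] as
    a pointwise limit of measurable functions. *)
Lemma continuous_measurable_config f : continuous f -> measurable_fun setT f.
Proof.
move=> cf; apply: (@measurable_fun_cvg _ _ _ setT
  (fun k w => f (recon k (levels k w))) f); first by move=> k; exact: measurable_recon.
move=> w _; suff h : (fun k => recon k (levels k w)) @ \oo --> w.
  by apply: (cvg_comp _ _ h); exact: cf.
apply: config_cvg => e; apply/cvgrPdist_le => dl dl0.
have [N _ hN] : \forall n \near \oo, dl^-1 <= n%:R by exact: nbhs_infty_ger.
exists (maxn N (idx e).+1) => // k; rewrite /= geq_max => /andP[Nk ek].
rewrite distrC (le_trans (recon_near _ ek))//.
rewrite invf_ple ?posrE// (le_trans (hN k Nk))// ler_nat; exact: leqnSn.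
Qed.

Definition Cb : set (config R d -> R) :=
  [set f | continuous f /\ exists M, forall w, `|f w| <= M].

Lemma Cb_bm f : Cb f -> bm f.
Proof. by move=> [cf fM]; split => //; exact: continuous_measurable_config. Qed.

Lemma Cb_cst (a : R) : Cb (fun=> a).
Proof. by split; [exact: cst_continuous|exists `|a|]. Qed.

Lemma Cb_add f g : Cb f -> Cb g -> Cb (fun w => f w + g w).
Proof.
move=> [cf [M fM]] [cg [N gN]]; split; first by move=> w; exact: (cvgD (cf w) (cg w)).
by exists (M + N) => x; rewrite (le_trans (ler_normD _ _))// lerD.
Qed.

Lemma Cb_mul f g : Cb f -> Cb g -> Cb (fun w => f w * g w).
Proof.
move=> [cf [M fM]] [cg [N gN]]; split; first by move=> w; exact: (cvgM (cf w) (cg w)).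
by exists (M * N) => x; rewrite normrM ler_pM.
Qed.

Lemma Cb_scale (a : R) f : Cb f -> Cb (fun w => a * f w).
Proof. by move=> ?; apply: Cb_mul => //; exact: Cb_cst. Qed.

Lemma Cb_sub f g : Cb f -> Cb g -> Cb (fun w => f w - g w).
Proof.
move=> Cf /(Cb_scale (-1)) Cg; have := Cb_add Cf Cg.
by rewrite (_ : (fun x => f x + -1 * g x) = (fun x => f x - g x))//;
  apply/funext => x; rewrite mulN1r.
Qed.

Lemma Cb_norm f : Cb f -> Cb (fun w => `|f w|).
Proof.
move=> [cf [M fM]]; split; first by move=> w; exact: (cvg_norm (cf w)).
by exists M => w; rewrite normr_id.
Qed.

Lemma Cb_pos f : Cb f -> Cb (fun w => Num.max 0 (f w)).
Proof.
move=> [cf [M fM]]; split.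
  by move=> w; exact: (@continuous_max R _ (cst 0) f w (@cst_continuous _ _ 0 w) (cf w)).
exists M => w; rewrite (le_trans _ (fM w))// /Num.max; case: ifP => //.
by rewrite normr0.
Qed.

Lemma Cb_tau x f : Cb f -> Cb (fun w => f (tau x w)).
Proof.
move=> [cf [M fM]]; split; last by exists M.
move=> w; apply: (@continuous_comp _ _ _ (@tau R d x) f); last exact: cf.
exact: continuous_tau.
Qed.

Lemma Cb_sum (I : Type) (s : seq I) (F : I -> config R d -> R) :
  (forall i, Cb (F i)) -> Cb (fun w => \sum_(i <- s) F i w).
Proof.
move=> CF; elim: s => [|i s IH].
  by under eq_fun do rewrite big_nil; exact: Cb_cst.
by under eq_fun do rewrite big_cons; exact: Cb_add.
Qed.

(** Cozero sets: a generating pi-system whose indicators are increasing limits of functions in [Cb].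
    It serves both the Daniell construction and the Dynkin arguments. *)
Definition pos_sets : set (set (config R d)) :=
  [set A | exists2 h, Cb h /\ (forall w, 0 <= h w) & A = [set w | 0 < h w]].

Lemma pos_sets_measurable : pos_sets `<=` measurable.
Proof.
move=> _ [h [Ch _] ->]; have [mh _] := Cb_bm Ch.
rewrite (_ : [set w | _] = h @^-1` `]0, +oo[).
  by rewrite -[X in measurable X]setTI; exact: mh.
by apply/seteqP; split => w /=; rewrite in_itv/= andbT.
Qed.

Lemma pos_sets_setI : setI_closed pos_sets.
Proof.
move=> _ _ [f [Cf f0] ->] [g [Cg g0] ->].
exists (fun w => f w * g w); first by split => [|w]; [exact: Cb_mul|exact: mulr_ge0].
apply/seteqP; split => w /=; first by move=> [? ?]; exact: mulr_gt0.
move=> fg; split; rewrite lt_neqAle ?f0 ?g0 andbT eq_sym;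
  by apply: contraTneq fg => ->; rewrite ?mul0r ?mulr0 ltxx.
Qed.

Lemma measurable_pos_sets : @measurable _ (config R d) = <<s pos_sets >>.
Proof.
apply/seteqP; split; last first.
  by apply: smallest_sub; [exact: sigma_algebra_measurable|exact: pos_sets_measurable].
apply: smallest_sub; first exact: smallest_sigma_algebra.
move=> _ [e [B mB ->]].
have : measurable_fun [set: g_sigma_algebraType pos_sets]
    (conductance e : g_sigma_algebraType pos_sets -> R).
  apply: (measurability (RGenOInfty.G (R := R))); first exact: RGenOInfty.measurableE.
  move=> _ [_ [a ->] <-]; rewrite setTI; apply: sub_sigma_algebra.
  (* This is the excess of the conductance over [a], clipped at 1: bounded, and positive exactly
     when the conductance exceeds [a]. *)
  pose h w := 1 - Num.max 0 (1 - Num.max 0 (conductance e w - a)).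
  exists h.
    split.
      split.
        have c1 : continuous (fun w : config R d => conductance e w - a).
          move=> w; have ce : continuous (conductance e : config R d -> R) by exact: continuous_conductance.
          exact: (cvgB (ce w) (cvg_cst a)).
        have c0 (b : R) : continuous (cst b : config R d -> R) by exact: cst_continuous.
        have c2 w := @continuous_max R (config R d) (cst 0) _ w (c0 0 w) (c1 w).
        have c3 : continuous (fun w : config R d => 1 - Num.max 0 (conductance e w - a)).
          by move=> w; exact: (cvgB (c0 1 w) (c2 w)).
        have c4 w := @continuous_max R (config R d) (cst 0) _ w (c0 0 w) (c3 w).
        by move=> w; exact: (cvgB (c0 1 w) (c4 w)).
      exists 1 => w; rewrite /h ger0_norm ?gerBl ?le_max ?lexx//.
      by rewrite subr_ge0 ge_max ler01 gerBl le_max lexx.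
    by move=> w; rewrite /h subr_ge0 ge_max ler01 gerBl le_max lexx.
  apply/seteqP; split => w /=; rewrite in_itv/= andbT /h subr_gt0 gt_max ltr01/=.
    by rewrite gtrBl lt_max ltxx/= subr_gt0.
  by rewrite gtrBl lt_max ltxx/= subr_gt0.
by move=> /(_ measurableT B mB); rewrite setTI.
Qed.

End config_measurability.

(** * The limit law of an averaging tight configuration *)

Section limit_law.
Variables (R : realType) (d : nat).
Implicit Types (f : config R d -> R).

Lemma Cb_bounded_fun f : Cb f -> bounded_fun f.
Proof.
move=> [_ [M fM]]; exists M; split; first exact: num_real.
by move=> N MN w _; rewrite /= (le_trans (fM w))// ltW.
Qed.

Lemma bounded_fun_Cb f : continuous f -> bounded_fun f -> Cb f.
Proof.
move=> cf [M [_ hM]]; split => //; exists (`|M| + 1) => w.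
by apply: (hM (`|M| + 1)) => //; rewrite (le_lt_trans (ler_norm M))// ltrDl.
Qed.

Lemma Cloc_Cb f : Cloc f -> Cb f.
Proof. by move=> fl; split; [have [] := fl|exact: Cloc_bounded]. Qed.

Variable w : config R d.

Lemma limit_law_exists : tight w -> averaging w ->
  exists P : probability (config R d) R, is_limit_law w P.
Proof.
move=> tw aw.
pose a f n := avg n (fun x => f (tau x w)).
pose L f := limn (a f).
have ca f : Cb f -> a f @ \oo --> L f.
  by move=> [cf [M fM]]; exact: (averaging_continuous tw aw cf fM).
have LE f l : a f @ \oo --> l -> L f = l by move=> h; exact: (cvg_lim (@Rhausdorff R) h).
have [|||||||||||P hP] := @daniell_stone _ (config R d) R (@Cb R d) L.
- exact: Cb_bm.
- exact: Cb_cst.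
- exact: Cb_add.
- exact: Cb_mul.
- exact: Cb_pos.
- move=> f g Cf Cg; apply: LE.
  rewrite (_ : a _ = fun n => a f n + a g n); first exact: cvgD (ca f Cf) (ca g Cg).
  by apply/funext => n; rewrite /a avgD.
- move=> c f Cf; apply: LE.
  rewrite (_ : a _ = fun n => c * a f n); first exact: cvgM (cvg_cst c) (ca f Cf).
  by apply/funext => n; rewrite /a avgZ.
- move=> f Cf f0; apply: limr_ge; first by apply/cvg_ex; exists (L f); exact: ca.
  by apply: nearW => n; apply: avg_ge0.
- by apply: LE; rewrite /a; under eq_fun do rewrite avg_cst; exact: cvg_cst.
- move=> f Cf fS f0.
  have fmono j k v : (j <= k)%N -> f k v <= f j v.
    move=> jk; rewrite -(subnKC jk); elim: (k - j)%N => [|i IH]; first by rewrite addn0.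
    by rewrite addnS (le_trans (fS _ _)).
  have fge0 k v : 0 <= f k v.
    have cv : cvg (f n v @[n --> \oo]) by apply/cvg_ex; exists 0; exact: f0.
    rewrite -(cvg_lim (@Rhausdorff R) (f0 v)); apply: limr_le => //.
    by exists k => // j /= kj; exact: fmono.
  have [M fM] := (Cf 0%N).2.
  have M0 : 0 <= M by exact: le_trans (fM w).
  apply/cvgrPdist_le => dl dl0.
  have D0 : 0 < 1 + M by rewrite ltr_pwDl.
  (* Dini gives at most [eta] on [inK eps k]; off it the bound is [M] and the frequency at most
     [eta]. *)
  pose eta := dl / (1 + M).
  have eta0 : 0 < eta by rewrite divr_gt0.
  have [eps eps0 heps] := tight_inK tw eta0.
  have [k hk] := dini_inK eps0 (fun k => (Cf k).1) fS f0 eta0.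
  have [N hN] := heps k.
  exists k => // j /= kj.
  have Lj0 : 0 <= L (f j).
    apply: limr_ge; first by apply/cvg_ex; exists (L (f j)); exact: ca.
    by apply: nearW => n; apply: avg_ge0.
  rewrite distrC subr0 ger0_norm//.
  apply: limr_le; first by apply/cvg_ex; exists (L (f j)); exact: ca.
  exists N => // n /= Nn.
  apply: (@le_trans _ _ (avg n (fun x => eta + M * (~~ inK eps k (tau x w))%:R))).
    apply: le_avg => x; rewrite (le_trans (fmono _ _ _ kj))//.
    have [xK|xK] := boolP (inK eps k (tau x w)).
      by rewrite mulr0 addr0 hk.
    rewrite mulr1 ler_wpDl ?(ltW eta0)// (le_trans (fmono 0%N _ _ _))//.
    exact: le_trans (ler_norm _) (fM _).
  rewrite avgD avg_cst avgZ.
  have -> : dl = eta * (1 + M) by rewrite /eta divfK// gt_eqF.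
  by rewrite mulrDr mulr1 lerD2l [leRHS]mulrC ler_wpM2l// hN.
- by rewrite measurable_pos_sets.
exists P => f cf bf; have Cf := bounded_fun_Cb cf bf.
rewrite unlock hP//; under eq_fun do rewrite mean_avg.
apply: cvg_EFin; first exact: nearW.
exact: ca.
Qed.

Variable P : probability (config R d) R.
Hypothesis wP : is_limit_law w P.

Lemma limit_law_cvg f : Cb f ->
  avg n (fun x => f (tau x w)) @[n --> \oo] --> Ex P f.
Proof.
move=> Cf; have := wP Cf.1 (Cb_bounded_fun Cf).
rewrite unlock -EFin_Ex; last exact: Cb_bm.
under eq_fun do rewrite mean_avg; exact: fine_cvg.
Qed.

Lemma Ex_tau_Cb y f : Cb f -> Ex P (fun v => f (tau y v)) = Ex P f.
Proof.
move=> Cf; have c1 := limit_law_cvg (Cb_tau y Cf).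
have c2 := limit_law_cvg Cf.
have [_ [M fM]] := Cf.
pose u n := avg n (fun x => f (tau y (tau x w))).
pose v n := avg n (fun x => f (tau x w)).
suff c3 : u n - v n @[n --> \oo] --> 0.
  have uE : u = fun n => v n + (u n - v n) by apply/funext => n; rewrite subrKC.
  have c4 : u @ \oo --> Ex P f.
    by rewrite uE -[X in _ --> X]addr0; exact: cvgD c2 c3.
  exact: (cvg_unique (@Rhausdorff R) c1 c4).
apply/cvgr0Pnorm_le => dl dl0.
have M0 : 0 <= M by exact: le_trans (fM w).
have dl1 : 0 < dl / (M + 1) by rewrite divr_gt0// ltr_wpDl.
have [N hN] := avg_shift y dl1.
exists N => // n /= Nn.
have := hN n Nn (fun x => f (tau x w)) M (fun x => fM _).
have -> : (fun x => f (tau (x + y) w)) = (fun x => f (tau y (tau x w))).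
  by apply/funext => x; rewrite tau_tau addrC.
move=> h; rewrite (le_trans h)// mulrCA ger_pMr// ler_pdivrMr ?mul1r ?lerDl//.
by rewrite ltr_wpDl.
Qed.

(** The integrands are [min 1 (j h)], which increase to the indicator of positivity of [h]. *)
Lemma Ex_pos_set h : Cb h -> (forall v, 0 <= h v) ->
  Ex P (fun v => 1 - Num.max 0 (1 - j%:R * h v)) @[j --> \oo] --> fine (P [set v | 0 < h v]).
Proof.
move=> Ch h0.
have mA : measurable [set v | 0 < h v] by apply: pos_sets_measurable; exists h.
rewrite -Ex_indic//.
have Cphi j : Cb (fun v => 1 - Num.max 0 (1 - j%:R * h v)).
  apply: Cb_sub; first exact: Cb_cst.
  by apply: Cb_pos; apply: Cb_sub; [exact: Cb_cst|exact: Cb_scale].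
apply: (@Ex_cvg _ _ _ P _ _ 1).
- by move=> j; have [] := Cb_bm (Cphi j).
- exact: measurable_indic.
- move=> j v; rewrite ger0_norm; first by rewrite gerBl le_max lexx.
  by rewrite subr_ge0 ge_max ler01 gerBl mulr_ge0.
- move=> v; rewrite indicE; case: (boolP (v \in _)) => [/set_mem /= hv|/negP hv].
    have [N _ hN] : \forall n \near \oo, (h v)^-1 <= n%:R by exact: nbhs_infty_ger.
    apply: cvg_near_cst; exists N => // j /= Nj.
    have -> : Num.max 0 (1 - j%:R * h v) = 0; last by rewrite subr0.
    apply/max_idPl; rewrite subr_le0 -ler_pdivrMr// div1r; exact: hN.
  have -> : h v = 0.
    apply/eqP; rewrite eq_le h0 andbT leNgt; apply/negP => p; apply: hv.
    exact/mem_set.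
  apply: cvg_near_cst; apply: nearW => j; rewrite mulr0 subr0.
  by have -> : Num.max 0 1 = 1 :> R; [exact/max_idPr|rewrite subrr].
Qed.

(** Invariance for functions in [Cb] passes to cozero sets through [Ex_pos_set] and to all
    measurable sets by Dynkin's lemma. *)
Lemma limit_law_invariant y (A : set (config R d)) : measurable A ->
  P (tau y @^-1` A) = P A.
Proof.
move=> mA.
have mt (B : set (config R d)) : measurable B -> measurable (tau y @^-1` B).
  by move=> mB; rewrite -[X in measurable X]setTI; exact: measurable_tau.
have : <<s @pos_sets R d >> A by rewrite -measurable_pos_sets.
pose inv (B : set (config R d)) := P (tau y @^-1` B) = P B.
apply: (@dynkin_induction _ (config R d) (@pos_sets R d) inv).
- exact: measurable_pos_sets.
- exact: pos_sets_setI.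
- by rewrite /inv preimage_setT.
- move=> _ [h [Ch h0] ->]; rewrite /inv.
  have c1 := Ex_pos_set Ch h0.
  have c2 := Ex_pos_set (Cb_tau y Ch) (fun v => h0 (tau y v)).
  have c3 : Ex P (fun v => 1 - Num.max 0 (1 - j%:R * h (tau y v))) @[j --> \oo]
      --> fine (P [set v | 0 < h v]).
    rewrite (_ : (fun j => _) = fun j => Ex P (fun v => 1 - Num.max 0 (1 - j%:R * h v)))//.
    apply/funext => j.
    apply: (@Ex_tau_Cb y (fun v => 1 - Num.max 0 (1 - j%:R * h v))).
    apply: Cb_sub; first exact: Cb_cst.
    by apply: Cb_pos; apply: Cb_sub; [exact: Cb_cst|exact: Cb_scale].
  have := cvg_unique (@Rhausdorff R) c2 c3 => E.
  have fin (B : set (config R d)) : measurable B -> P B \is a fin_num.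
    by move=> mB; apply: fin_num_measure.
  have mh : measurable [set v | 0 < h v] by apply: pos_sets_measurable; exists h.
  by rewrite -[RHS](fineK (fin _ mh)) -E (fineK (fin _ (mt _ mh))).
- move=> B mB; rewrite /inv preimage_setC !probability_setC// => [->//|].
  exact: mt.
- move=> F mF tF invF; rewrite /inv preimage_bigcup.
  rewrite !measure_bigcup//.
  + by apply: eq_eseriesr => i _; exact: invF.
  + by move=> i _; exact: mt.
  + apply/trivIsetP => /= i j _ _ ij; rewrite -preimage_setI.
    by move/trivIsetP : tF => /(_ _ _ I I ij) ->; rewrite preimage_set0.
Qed.

Lemma Ex_tau y f : bm f -> Ex P (fun v => f (tau y v)) = Ex P f.
Proof.
move=> bf; rewrite /Ex /Rintegral; congr fine.
have mt := @measurable_tau R d y.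
have bft : bm (fun v => f (tau y v)).
  by split; [exact: measurableT_comp bf.1 mt|have [_ [M fM]] := bf; exists M].
have mf : measurable_fun setT (EFin \o f) by apply/measurable_EFinP; have [] := bf.
have := @integral_pushforward _ _ _ _ R (@tau R d y) mt P setT (EFin \o f) mf
  (bm_integrable P bft) measurableT.
rewrite preimage_setT /= => <-.
by apply: eq_measure_integral => A mA _; exact: limit_law_invariant.
Qed.

Lemma bm_tau y f : bm f -> bm (fun v => f (tau y v)).
Proof.
move=> bf; split; first exact: measurableT_comp bf.1 (measurable_tau y).
by have [_ [M fM]] := bf; exists M.
Qed.

(** The deviation [|f - h|] is itself in [Cb], so its orbit averages converge to its expectation and
    transfer their bound. *)
Lemma approx_Cloc_Ex f (dl : R) : tight w -> Cb f -> 0 < dl ->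
  exists2 h : config R d -> R, Cloc h & Ex P (fun v => `|f v - h v|) <= dl.
Proof.
move=> tw [cf [M fM]] dl0.
have [h [hloc hM [N hN]]] := approx_Cloc tw cf fM dl0.
exists h => //.
have Cfh : Cb (fun v => `|f v - h v|).
  by apply: Cb_norm; apply: Cb_sub; [split => //; exists M|exact: Cloc_Cb].
have c := limit_law_cvg Cfh.
rewrite -(cvg_lim (@Rhausdorff R) c); apply: limr_le.
  by apply/cvg_ex; eexists; exact: c.
by exists N => // n /= Nn; exact: hN.
Qed.

End limit_law.

(** * Mean ergodic theorem *)

Section mean_ergodic.
Variables (R : realType) (d : nat) (P : probability (config R d) R).
Hypothesis P_inv : forall y (g : config R d -> R), bm g ->
  Ex P (fun v => g (tau y v)) = Ex P g.
Implicit Types (f g : config R d -> R).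

Definition orbit_avg f n (v : config R d) : R := avg n (fun y => f (tau y v)).

Lemma bm_avg n (G : 'rV[int]_d -> config R d -> R) : (forall y, bm (G y)) ->
  bm (fun v => avg n (fun y => G y v)).
Proof. by move=> bG; apply: bmZ; exact: bm_sum. Qed.

Lemma Ex_avg n (G : 'rV[int]_d -> config R d -> R) : (forall y, bm (G y)) ->
  Ex P (fun v => avg n (fun y => G y v)) = avg n (fun y => Ex P (G y)).
Proof. by move=> bG; rewrite ExZ ?Ex_sum//; exact: bm_sum. Qed.

Lemma bm_orbit_avg f n : bm f -> bm (orbit_avg f n).
Proof. by move=> bf; apply: bm_avg => y; exact: bm_tau. Qed.

Lemma Ex_orbit_avg f n : bm f -> Ex P (orbit_avg f n) = Ex P f.
Proof.
move=> bf; rewrite Ex_avg; last by move=> y; exact: bm_tau.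
rewrite (_ : (fun _ => _) = fun=> Ex P f) ?avg_cst//.
by apply/funext => y; exact: P_inv.
Qed.

(** Non-negativity of the variance. *)
Lemma avg_sqr_le n (G : 'rV[int]_d -> R) :
  avg n G ^+ 2 <= avg n (fun y => G y ^+ 2).
Proof.
have : 0 <= avg n (fun y => (G y - avg n G) ^+ 2).
  by apply: avg_ge0 => y; exact: sqr_ge0.
set c := avg n G.
have -> : (fun y => (G y - c) ^+ 2) = fun y => G y ^+ 2 - (2 * c * G y - c ^+ 2).
  by apply/funext => y; ring.
rewrite avgB avgB avgZ avg_cst -/c; nra.
Qed.

Lemma Ex_orbit_avg_sqr f n : bm f ->
  Ex P (fun v => orbit_avg f n v ^+ 2) <= Ex P (fun v => f v ^+ 2).
Proof.
move=> bf.
have b2 g : bm g -> bm (fun v => g v ^+ 2) by move=> bg; exact: bmM.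
apply: (@le_trans _ _ (Ex P (orbit_avg (fun v => f v ^+ 2) n))).
  apply: le_Ex; [exact/b2/bm_orbit_avg|exact/bm_orbit_avg/b2|].
  by move=> v; exact: avg_sqr_le.
by rewrite Ex_orbit_avg//; exact: b2.
Qed.

Variables (f : config R d -> R) (M : R).
Hypothesis bf : bm f.
Hypothesis fM : forall v, `|f v| <= M.

Let A := orbit_avg f.
Let l := Ex P f.

Let bA n : bm (A n).
Proof. exact: bm_orbit_avg. Qed.

Let AM n v : `|A n v| <= M.
Proof. exact: avg_bounded. Qed.

Let M0 : 0 <= M.
Proof. by apply: le_trans (fM point). Qed.

Let b2 g : bm g -> bm (fun v => g v ^+ 2).
Proof. by move=> bg; exact: bmM. Qed.

Let q n := Ex P (fun v => A n v ^+ 2).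

(** Stands in for the convex hull of the orbit of [f]: the averages [A k] and their midpoints
    qualify, and by [m_le] such functions, when bounded by [M], have second moment at least [m]. *)
Let asym g := forall dl, 0 < dl -> exists N, forall n, (N <= n)%N ->
  forall v, `|orbit_avg g n v - A n v| <= dl.

Let asym_A k : asym (A k).
Proof.
move=> dl dl0; have dl1 : 0 < dl / (M + 1) by rewrite divr_gt0// ltr_wpDl.
have [N hN] := avg_avg d k dl1; exists N => n Nn v.
have := hN n Nn (fun x => f (tau x v)) M (fun x => fM _).
rewrite (_ : avg n (fun x => avg k _) = orbit_avg (A k) n v).
  move=> h; rewrite (le_trans h)// mulrCA ger_pMr// ler_pdivrMr ?mul1r ?lerDl//.
  by rewrite ltr_wpDl.
congr avg; apply/funext => x; congr avg; apply/funext => y.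
by rewrite tau_tau addrC.
Qed.

Let asym_mid j k : asym (fun v => 2^-1 * (A j v + A k v)).
Proof.
move=> dl dl0; have [N hN] := asym_A j dl0; have [N' hN'] := asym_A k dl0.
exists (maxn N N') => n; rewrite geq_max => /andP[Nn N'n] v.
rewrite /orbit_avg avgZ avgD -/(orbit_avg _ _ _) -/(orbit_avg _ _ _).
have := hN n Nn v; have := hN' n N'n v; rewrite !ler_norml.
by move=> /andP[? ?] /andP[? ?]; apply/andP; split; lra.
Qed.

(** Averaging contracts the second moment, and [A n] is uniformly close to the average of [g]. The
    difference of squares factors, with [2 M + 1] bounding the sum and positive. *)
Let q_le g : bm g -> (forall v, `|g v| <= M) -> asym g -> forall dl, 0 < dl ->
  exists N, forall n, (N <= n)%N -> q n <= Ex P (fun v => g v ^+ 2) + dl.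
Proof.
move=> bg gM ag dl dl0.
have D0 : 0 < 2 * M + 1 by rewrite ltr_wpDl// mulr_ge0.
have dl1 : 0 < dl / (2 * M + 1) by rewrite divr_gt0.
have [N hN] := ag _ dl1; exists N => n Nn.
have bgn := bm_orbit_avg n bg.
apply: (@le_trans _ _ (Ex P (fun v => orbit_avg g n v ^+ 2 + dl))).
  apply: le_Ex; [exact: b2|by apply: bmD; [exact: b2|exact: bm_cst]|move=> v].
  have h1 := hN n Nn v; have h2 := AM n v.
  have h3 : `|orbit_avg g n v| <= M by exact: avg_bounded.
  have h4 : `|orbit_avg g n v - A n v| * `|orbit_avg g n v + A n v| <=
      dl / (2 * M + 1) * (2 * M + 1).
    rewrite ler_pM// (le_trans (ler_normD _ _))//.
    by rewrite (le_trans (lerD h3 h2))//; lra.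
  rewrite divfK ?gt_eqF// -normrM -subr_sqr in h4.
  by move: h4; rewrite ler_norml => /andP[]; lra.
rewrite ExD ?Ex_cst ?lerD2r; [exact: Ex_orbit_avg_sqr|exact: b2|exact: bm_cst].
Qed.

Let m := inf (range q).

Let m_has_inf : has_inf (range q).
Proof.
split; first by exists (q 0%N), 0%N.
by exists 0 => _ [n _ <-]; apply: Ex_ge0 => v; exact: sqr_ge0.
Qed.

Let m_le_q n : m <= q n.
Proof. by apply: ge_inf; [exact: m_has_inf.2|exists n]. Qed.

Let m_le g : bm g -> (forall v, `|g v| <= M) -> asym g -> m <= Ex P (fun v => g v ^+ 2).
Proof.
move=> bg gM ag; apply/ler_addgt0Pr => dl dl0.
have [N hN] := q_le bg gM ag dl0.
exact: le_trans (m_le_q N) (hN N (leqnn N)).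
Qed.

Let q_near dl : 0 < dl -> exists N, forall n, (N <= n)%N -> q n <= m + dl.
Proof.
move=> dl0; have dl2 : 0 < dl / 2 by rewrite divr_gt0.
have [_ [k _ <-] hk] := inf_adherent dl2 m_has_inf.
have [N hN] := q_le (bA k) (AM k) (@asym_A k) dl2.
exists N => n /hN /le_trans; apply; rewrite -/(q k); lra.
Qed.

(** Parallelogram law: the midpoint has second moment at least [m], so the squared distance is at
    most [2 q j + 2 q k - 4 m], and an excess [dl / 4] in each of [q j], [q k] gives [dl]. *)
Let cauchy_L2 dl : 0 < dl -> exists N, forall j k, (N <= j)%N -> (N <= k)%N ->
  Ex P (fun v => (A j v - A k v) ^+ 2) <= dl.
Proof.
move=> dl0; have dl4 : 0 < dl / 4 by rewrite divr_gt0.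
have [N hN] := q_near dl4; exists N => j k Nj Nk.
pose g v := 2^-1 * (A j v + A k v).
have bg : bm g by apply: bmZ; exact: bmD.
have gM v : `|g v| <= M.
  have := AM j v; have := AM k v; rewrite !ler_norml /g.
  by move=> /andP[? ?] /andP[? ?]; apply/andP; split; lra.
have mg := m_le bg gM (asym_mid j k).
have -> : (fun v => (A j v - A k v) ^+ 2) =
    fun v => (2 * A j v ^+ 2 + 2 * A k v ^+ 2) - 4 * g v ^+ 2.
  by apply/funext => v; rewrite /g; field.
have bj := b2 (bA j); have bk := b2 (bA k); have bg2 := b2 bg.
rewrite ExB; [|by apply: bmD; exact: bmZ|exact: bmZ].
rewrite ExD; [|exact: bmZ|exact: bmZ].
rewrite !ExZ// -/(q j) -/(q k).
have := hN j Nj; have := hN k Nk; lra.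
Qed.

Let cauchy_L1 (k : nat) : exists N, forall i j, (N <= i)%N -> (N <= j)%N ->
  Ex P (fun v => `|A i v - A j v|) <= 2^-1 ^+ k.
Proof.
pose t : R := 2^-1 ^+ k.
have t0 : 0 < t by rewrite exprn_gt0.
have [N hN] := cauchy_L2 (mulr_gt0 t0 t0); exists N => i j Ni Nj.
have h := hN i j Ni Nj.
have bij : bm (fun v => A i v - A j v) by exact: bmB.
have bij2 := b2 bij.
(* The pointwise bound [|x| <= t / 2 + x ^ 2 / (2 t)], optimized at [|x| = t], replaces the
   Cauchy-Schwarz inequality. *)
apply: (@le_trans _ _ (Ex P (fun v => t / 2 + (2 * t)^-1 * (A i v - A j v) ^+ 2))).
  apply: le_Ex; [exact: bm_norm|by apply: bmD; [exact: bm_cst|exact: bmZ]|move=> v].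
  set x := A i v - A j v.
  have : 0 <= (2 * t)^-1 * (`|x| - t) ^+ 2.
    by rewrite mulr_ge0 ?sqr_ge0// invr_ge0 mulr_ge0// ltW.
  rewrite sqrrB real_normK ?num_real//.
  have -> : (2 * t)^-1 * (x ^+ 2 - `|x| * t *+ 2 + t ^+ 2) =
      t / 2 + (2 * t)^-1 * x ^+ 2 - `|x|.
    by field; rewrite gt_eqF.
  lra.
rewrite ExD; [|exact: bm_cst|exact: bmZ].
rewrite Ex_cst ExZ// -/t.
have : (2 * t)^-1 * Ex P (fun v => (A i v - A j v) ^+ 2) <= t / 2.
  by rewrite ler_pdivrMl ?mulr_gt0// (le_trans h)//; lra.
lra.
Qed.

(** The rates [2 ^ - k] are summable, which will make the increments summable in mean. A running
    maximum gives monotonicity, and [k <= nn k] lets bounds valid for large indices apply along the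
    subsequence. *)
Let subseq_exists : exists nn : nat -> nat, (forall k, (k <= nn k)%N) /\
  forall k i, (nn k <= i)%N -> Ex P (fun v => `|A i v - A (nn k) v|) <= 2^-1 ^+ k
    /\ (nn k <= nn k.+1)%N.
Proof.
have /choice [N hN] := cauchy_L1.
pose nn k := \max_(i < k.+1) maxn (N i) i.
have nnP k : (maxn (N k) k <= nn k)%N.
  exact: (leq_bigmax (F := fun i : 'I_k.+1 => maxn (N i) i) ord_max).
exists nn; split => [k|k i ki]; first by rewrite (leq_trans _ (nnP k))// leq_maxr.
have Nk : (N k <= nn k)%N by rewrite (leq_trans _ (nnP k))// leq_maxl.
split; first by apply: hN => //; exact: leq_trans ki.
by rewrite /nn [leqRHS]big_ord_recr/= leq_maxl.
Qed.

(* The limsup of the averages along any subsequence is strictly invariant,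
   since [orbit_avg f n (tau y v) - orbit_avg f n v] tends to 0. *)
Let A_shift y dl : 0 < dl -> exists N, forall n, (N <= n)%N -> forall v,
  `|A n (tau y v) - A n v| <= dl.
Proof.
move=> dl0; have dl1 : 0 < dl / (M + 1) by rewrite divr_gt0// ltr_wpDl.
have [N hN] := avg_shift y dl1; exists N => n Nn v.
have := hN n Nn (fun x => f (tau x v)) M (fun x => fM _).
rewrite (_ : avg n _ = A n (tau y v)).
  move=> h; rewrite (le_trans h)// mulrCA ger_pMr// ler_pdivrMr ?mul1r ?lerDl//.
  by rewrite ltr_wpDl.
by congr avg; apply/funext => x; rewrite tau_tau.
Qed.

Hypothesis P_erg : forall B : set (config R d), measurable B ->
  (forall x, tau x @^-1` B = B) -> P B = 0%E \/ P B = 1%E.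

(** The pointwise limsup [h] of the subsequence is also its limit in mean, because the increments
    are summable. Ergodicity is then applied to the single event [l < h]: being null or full it
    gives [h - l] a constant sign almost surely, and a function of constant sign and mean 0 vanishes
    almost surely. *)
Lemma mean_ergodic : Ex P (fun v => `|orbit_avg f n v - l|) @[n --> \oo] --> 0.
Proof.
have [nn [nnk hnn]] := subseq_exists.
pose a v k := A (nn k) v.
have aM v k : `|a v k| <= M by exact: AM.
have a_ub v : has_ubound (range (a v)).
  by exists M => _ [k _ <-]; exact: le_trans (ler_norm _) (aM v k).
have a_lb v : has_lbound (range (a v)).
  by exists (- M) => _ [k _ <-]; have := aM v k; rewrite ler_norml => /andP[].
pose h v := inf (range (sups (a v))).
have sh v : sups (a v) k @[k --> \oo] --> h v by exact: cvg_sups_inf.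
have s_ge v k j : (k <= j)%N -> a v j <= sups (a v) k.
  move=> kj; apply: ub_le_sup; last by exists j.
  by have [B hB] := a_ub v; exists B => _ [i _ <-]; apply: hB; exists i.
have s_le v k B : (forall j, (k <= j)%N -> a v j <= B) -> sups (a v) k <= B.
  move=> hB; apply: ge_sup; first by exists (a v k), k => /=.
  by move=> _ [j /= kj <-]; exact: hB.
have sM v k : `|sups (a v) k| <= M.
  rewrite ler_norml; apply/andP; split.
    by apply: le_trans (s_ge v k k (leqnn k)); have := aM v k; rewrite ler_norml => /andP[].
  by apply: s_le => j _; exact: le_trans (ler_norm _) (aM v j).
have ms k : measurable_fun setT (fun v => sups (a v) k).
  apply: (@measurable_fun_sups _ _ _ setT (fun k v => a v k)) => //.
  by move=> j; have [] := bA (nn j).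
have bs k : bm (fun v => sups (a v) k) by split => //; exists M.
have mh : measurable_fun setT h by exact: (@measurable_fun_cvg _ _ _ setT (fun k v => sups (a v) k)).
have hM v : `|h v| <= M.
  have c : `|sups (a v) k| @[k --> \oo] --> `|h v| by apply: cvg_norm; exact: sh.
  rewrite -(cvg_lim (@Rhausdorff R) c); apply: limr_le; first by apply/cvg_ex; eexists; exact: c.
  by apply: nearW => k.
have bh : bm h by split => //; exists M.
have h_inv y v : h (tau y v) <= h v.
  apply/ler_addgt0Pr => dl dl0; have [N hN] := A_shift y dl0.
  have c : sups (a v) k + dl @[k --> \oo] --> h v + dl.
    by apply: cvgD; [exact: sh|exact: cvg_cst].
  rewrite -(cvg_lim (@Rhausdorff R) (sh (tau y v))) -(cvg_lim (@Rhausdorff R) c).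
  apply: ler_lim; [by apply/cvg_ex; eexists; exact: sh|by apply/cvg_ex; eexists; exact: c|].
  exists N => // k /= Nk; apply: s_le => j kj.
  have := hN (nn j) (leq_trans (leq_trans Nk kj) (nnk j)) v.
  rewrite ler_norml => /andP[_]; rewrite lerBlDr addrC => /le_trans; apply.
  by rewrite lerD2r; exact: s_ge.
have h_invE y v : h (tau y v) = h v.
  apply/eqP; rewrite eq_le h_inv/=.
  by rewrite -{1}(tau0 v) -(addNr y) -tau_tau h_inv.
(* A tail supremum exceeds [a v k] by at most the total variation after [k], whose mean is at most
   the sum of [2 ^ - (k + i)] over [i]. *)
have Es k : Ex P (fun v => sups (a v) k - a v k) <= 2 * 2^-1 ^+ k.
  pose b K v := \sum_(i < K) `|a v (k + i).+1 - a v (k + i)%N|.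
  have bb K : bm (b K).
    by apply: bm_sum => i; apply: bm_norm; apply: bmB; exact: bA.
  have b0 K v : 0 <= b K v by apply: sumr_ge0.
  have bS K v : b K v <= b K.+1 v by rewrite /b big_ord_recr/= lerDl.
  (* The total variation may be infinite at some points; truncating at [2 M], which bounds the
     differences of the [a v k], keeps its limit within bounded convergence. *)
  pose c K v := Num.min (2 * M) (b K v).
  have c0 K v : 0 <= c K v by rewrite le_min b0 mulr_ge0.
  have cM K v : c K v <= 2 * M by rewrite ge_min lexx.
  have mc K : measurable_fun setT (c K).
    by apply: measurable_minr; [exact: measurable_cst|exact: (bb K).1].
  have bc K : bm (c K).
    by split => //; exists (2 * M) => v; rewrite ger0_norm.
  have c_nd v : nondecreasing_seq (c ^~ v).
    apply/nondecreasing_seqP => K.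
    by rewrite /c le_min !ge_min lexx/= bS orbT.
  have c_ub v : has_ubound (range (c ^~ v)) by exists (2 * M) => _ [K _ <-].
  pose cc v := sup (range (c ^~ v)).
  have ccc v : c K v @[K --> \oo] --> cc v by exact: nondecreasing_cvgn.
  have mcc : measurable_fun setT cc by exact: (@measurable_fun_cvg _ _ _ setT c).
  have ccM v : `|cc v| <= 2 * M.
    have cn : `|c K v| @[K --> \oo] --> `|cc v| by apply: cvg_norm; exact: ccc.
    rewrite -(cvg_lim (@Rhausdorff R) cn); apply: limr_le; first by apply/cvg_ex; eexists; exact: cn.
    by apply: nearW => K; rewrite ger0_norm.
  have bcc : bm cc by split => //; exists (2 * M).
  have tel K v : a v (k + K)%N - a v k <= b K v.
    elim: K => [|K IH]; first by rewrite addn0 subrr /b big_ord0.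
    rewrite /b big_ord_recr/= -/(b K v) addnS.
    have := ler_norm (a v (k + K).+1 - a v (k + K)%N); lra.
  apply: (@le_trans _ _ (Ex P cc)).
    apply: le_Ex => //; first by apply: bmB => //; exact: bA.
    move=> v; rewrite lerBlDr; apply: s_le => j kj; rewrite -lerBlDr.
    apply: (@le_trans _ _ (c (j - k)%N v)).
      rewrite le_min; apply/andP; split.
        have := aM v j; have := aM v k; rewrite !ler_norml.
        by move=> /andP[? ?] /andP[? ?]; lra.
      by have := tel (j - k)%N v; rewrite subnKC.
    by apply: ub_le_sup => //; exists (j - k)%N.
  have Ec : Ex P (c K) @[K --> \oo] --> Ex P cc.
    by apply: (@Ex_cvg _ _ _ P c cc (2 * M)) => // K v; rewrite ger0_norm.
  rewrite -(cvg_lim (@Rhausdorff R) Ec); apply: limr_le; first by apply/cvg_ex; eexists; exact: Ec.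
  apply: nearW => K.
  apply: (@le_trans _ _ (Ex P (b K))).
    by apply: le_Ex => // v; rewrite ge_min lexx orbT.
  rewrite /b Ex_sum; last by move=> i; apply: bm_norm; apply: bmB; exact: bA.
  apply: (@le_trans _ _ (\sum_(i < K) 2^-1 ^+ (k + i))).
    apply: ler_sum => i _.
    have [h1 h2] := hnn (k + i)%N _ (leqnn _).
    by have [] := hnn (k + i)%N (nn (k + i).+1) h2.
  under eq_bigr do rewrite exprD.
  rewrite -mulr_sumr mulrC ler_wpM2r ?exprn_ge0//.
  have := sum_half_le1 R K; under eq_bigr do rewrite exprS.
  by rewrite -mulr_sumr; lra.
have Eha : Ex P (fun v => `|h v - a v k|) @[k --> \oo] --> 0.
  have c1 : Ex P (fun v => `|h v - sups (a v) k|) @[k --> \oo] --> Ex P (fun=> 0).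
    apply: (@Ex_cvg _ _ _ P _ _ (2 * M)).
    - by move=> k; have [] := bm_norm (bmB bh (bs k)).
    - exact: measurable_cst.
    - move=> k v; rewrite normr_id (le_trans (ler_normB _ _))//.
      by have := hM v; have := sM v k; lra.
    - move=> v; rewrite -(normr0 R) -(subrr (h v)).
      by apply: cvg_norm; apply: cvgB; [exact: cvg_cst|exact: sh].
  have c2 : 2 * 2^-1 ^+ k @[k --> \oo] --> (2 * 0 : R).
    apply: cvgM; first exact: cvg_cst.
    by apply: cvg_expr; rewrite ger0_norm ?invr_ge0// invf_lt1 ?ltr1n.
  rewrite Ex_cst in c1; rewrite mulr0 in c2.
  have c3 : Ex P (fun v => `|h v - sups (a v) k|) + 2 * 2^-1 ^+ k @[k --> \oo] --> 0.
    by rewrite -[X in _ --> X](addr0 0); exact: cvgD.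
  apply: (squeeze_cvgr _ (cvg_cst 0) c3).
  apply: nearW => k; rewrite Ex_ge0//=.
  have bsa : bm (fun v => sups (a v) k - a v k) by apply: bmB => //; exact: bA.
  have bhs : bm (fun v => `|h v - sups (a v) k|) by apply: bm_norm; exact: bmB.
  apply: le_trans (lerD (lexx _) (Es k)); rewrite -ExD//.
  apply: le_Ex; [by apply: bm_norm; apply: bmB => //; exact: bA|exact: bmD|move=> v].
  rewrite -[leLHS]/`|h v - a v k| -(subrKA (sups (a v) k)).
  rewrite (le_trans (ler_normD _ _))// lerD2l ger0_norm// subr_ge0; exact: s_ge.
have Eh : Ex P h = l.
  apply/eqP; rewrite -subr_eq0 -normr_le0; apply/ler_addgt0Pr => dl dl0; rewrite add0r.
  have /cvgr0Pnorm_lt/(_ _ dl0) [N _ /(_ N (leqnn N)) /= hN] := Eha.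
  have <- : Ex P (A (nn N)) = l by exact: Ex_orbit_avg.
  rewrite -ExB; [|exact: bh|exact: bA].
  rewrite (le_trans (Ex_norm _ _))//; first by apply: bmB => //; exact: bA.
  exact: le_trans (ler_norm _) (ltW hN).
have hl : Ex P (fun v => `|h v - l|) = 0.
  pose G := [set v | l < h v].
  have mG : measurable G.
    rewrite (_ : G = h @^-1` `]l, +oo[); first by rewrite -[X in measurable X]setTI; exact: mh.
    by apply/seteqP; split => v /=; rewrite in_itv/= andbT.
  have lM : `|l| <= M.
    rewrite (le_trans (Ex_norm P bf))// -[leRHS](Ex_cst P).
    by apply: le_Ex => //; [exact: bm_norm|exact: bm_cst].
  have b0 : bm (fun v => h v - l) by apply: bmB => //; exact: bm_cst.
  have E0 : Ex P (fun v => h v - l) = 0.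
    by rewrite ExB ?Ex_cst ?Eh ?subrr//; exact: bm_cst.
  (* Since [|h - l| <= 2 M], adding [4 M] on the null set among [G] and its complement dominates
     [|h - l|] by a function of mean 0. *)
  have bG B : measurable B -> bm (fun v => 4 * M * \1_B v) by move=> mB; apply: bmZ; exact: bm_indic.
  have dM v : `|h v - l| <= 2 * M.
    by rewrite (le_trans (ler_normB _ _))//; have := hM v; lra.
  apply/eqP; rewrite eq_le Ex_ge0// andbT.
  have [PG|PG] : P G = 0%E \/ P G = 1%E.
    apply: P_erg => // x; apply/seteqP; split => v /=; by rewrite /G /= h_invE.
  - apply: (@le_trans _ _ (Ex P (fun v => 4 * M * \1_G v - (h v - l)))).
      apply: le_Ex; [exact: bm_norm|by apply: bmB => //; exact: bG|move=> v].
      rewrite indicE; case: (boolP (v \in G)) => [_|/negP vG].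
        rewrite mulr1; have := dM v; have := ler_norm (h v - l).
        by have := ler_norm (- (h v - l)); rewrite normrN; lra.
      rewrite mulr0 sub0r ler0_norm// subr_le0 leNgt; apply/negP => lh.
      by apply: vG; exact/mem_set.
    rewrite ExB//; last exact: bG.
    rewrite E0 ExZ; last exact: bm_indic.
    by rewrite Ex_indic// PG mulr0 subrr.
  - apply: (@le_trans _ _ (Ex P (fun v => 4 * M * \1_(~` G) v + (h v - l)))).
      apply: le_Ex; [exact: bm_norm|by apply: bmD => //; apply: bG; exact: measurableC|move=> v].
      rewrite indicE in_setC; case: (boolP (v \in G)) => [/set_mem vG|_].
        by rewrite mulr0 add0r ger0_norm// subr_ge0 ltW.
      rewrite mulr1; have := dM v; have := ler_norm (h v - l).
        by have := ler_norm (- (h v - l)); rewrite normrN; lra.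
    rewrite ExD//; last by apply: bG; exact: measurableC.
    rewrite E0 ExZ; last by apply: bm_indic; exact: measurableC.
    rewrite Ex_indic; last exact: measurableC.
    by rewrite probability_setC// PG subee//= mulr0 addr0.
(* Back from the subsequence to all [n]: beyond [nn k] every average is within [2 ^ - k] in mean of
   the one at [nn k]. *)
apply/cvgr0Pnorm_le => dl dl0.
have dl2 : 0 < dl / 2 by rewrite divr_gt0.
have c2 : 2^-1 ^+ k @[k --> \oo] --> (0 : R).
  by apply: cvg_expr; rewrite ger0_norm ?invr_ge0// invf_lt1 ?ltr1n.
have /cvgr0Pnorm_lt/(_ _ dl2) [N1 _ hN1] := Eha.
have /cvgr0Pnorm_lt/(_ _ dl2) [N2 _ hN2] := c2.
pose k := maxn N1 N2.
have h1 := hN1 k (leq_maxl _ _); have h2 := hN2 k (leq_maxr _ _).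
exists (nn k) => // n /= kn.
rewrite ger0_norm; last exact: Ex_ge0.
have [h3 _] := hnn k n kn.
have bl : bm (fun v => h v - l) by apply: bmB => //; exact: bm_cst.
have bha : bm (fun v => `|h v - a v k|) by apply: bm_norm; apply: bmB => //; exact: bA.
have bna : bm (fun v => `|A n v - a v k|) by apply: bm_norm; apply: bmB; exact: bA.
apply: (@le_trans _ _ (Ex P (fun v => `|A n v - a v k| + (`|h v - a v k| + `|h v - l|)))).
  apply: le_Ex.
  - by apply: bm_norm; apply: bmB; [exact: bA|exact: bm_cst].
  - by apply: bmD => //; apply: bmD => //; exact: bm_norm.
  - move=> v; rewrite -/(A n v).
    have -> : A n v - l = (A n v - a v k) + (- (h v - a v k) + (h v - l)) by ring.
    rewrite (le_trans (ler_normD _ _))// lerD2l (le_trans (ler_normD _ _))//.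
    by rewrite normrN.
rewrite ExD//; last by apply: bmD => //; exact: bm_norm.
rewrite ExD//; last exact: bm_norm.
rewrite hl addr0 [leRHS](splitr dl) lerD//.
  apply: le_trans h3 _; apply: le_trans (ler_norm _) _; exact: ltW.
by apply: le_trans (ler_norm _) _; exact: ltW.
Qed.

End mean_ergodic.

(** * Block averages *)

Section proposition.
Variables (R : realType) (d : nat) (w : config R d).
Implicit Types (f g : config R d -> R).

Let block_dev f (l r : R) (n : nat) : R :=
  mean (Lambda d (n%:R : R)) (fun x =>
    `| mean (Lambda d r) (fun y => f (tau (x + y) w)) - l |).

Lemma block_devE f l r n : 0 <= r -> block_dev f l r n =
  avg n (fun x => `|orbit_avg f (Num.truncn r) (tau x w) - l|).
Proof.
move=> r0; rewrite /block_dev mean_avg; congr avg; apply/funext => x.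
rewrite mean_avg_real//; congr (`|_ - _|); congr avg; apply/funext => y.
by rewrite tau_tau addrC.
Qed.

Lemma Cb_orbit_avg f n : Cb f -> Cb (orbit_avg f n).
Proof. by move=> Cf; apply: Cb_scale; apply: Cb_sum => y; exact: Cb_tau. Qed.

(** For fixed [r] the deviation of the block average from [l] is again a function in [Cb], so the
    limsup over [n] is a limit, namely its expectation, to which the mean ergodic theorem
    applies. *)
Lemma block_dev_cvg0 f (P : probability (config R d) R) : is_limit_law w P ->
  (forall A : set (config R d), measurable A ->
    (forall x, tau x @^-1` A = A) -> P A = 0%E \/ P A = 1%E) ->
  Cloc f -> (fun r => limn_esup (fun n => (block_dev f (Ex P f) r n)%:E)) @ +oo
    --> 0%E.
Proof.
move=> wP erg /Cloc_Cb Cf; set l := Ex P f.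
have Cr k : Cb (fun v => `|orbit_avg f k v - l|).
  by apply: Cb_norm; apply: Cb_sub; [exact: Cb_orbit_avg|exact: Cb_cst].
have lim_r r : 0 <= r -> limn_esup (fun n => (block_dev f l r n)%:E) =
    (Ex P (fun v => `|orbit_avg f (Num.truncn r) v - l|))%:E.
  move=> r0.
  have c := limit_law_cvg wP (Cr (Num.truncn r)).
  have [|_ ->//] := @cvg_limn_einf_sup R (fun n => (block_dev f l r n)%:E)
    (Ex P (fun v => `|orbit_avg f (Num.truncn r) v - l|))%:E.
  apply: cvg_EFin; first exact: nearW.
  by under [X in X @ _ --> _]eq_fun do rewrite /= block_devE//.
have [M fM] := Cf.2.
have me := mean_ergodic (fun y g => Ex_tau wP y (f := g)) (Cb_bm Cf) fM erg.
have c : (fun r : R => (Ex P (fun v => `|orbit_avg f (Num.truncn r) v - l|))%:E)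
    @ +oo --> 0%E.
  apply: cvg_EFin; first exact: nearW.
  apply/cvgr0Pnorm_le => dl dl0.
  have /cvgr0Pnorm_le/(_ _ dl0) [N _ hN] := me.
  near=> r; apply: (hN (Num.truncn r)) => /=.
  have rN : N%:R <= r by near: r; exact: nbhs_pinfty_ge.
  by rewrite truncn_ge_nat// (le_trans _ rN).
apply: cvg_trans c; apply: near_eq_cvg; near=> r.
by rewrite lim_r//; near: r; exact: nbhs_pinfty_ge.
Unshelve. all: by end_near. Qed.

Lemma block_dev_small f l :
  (fun r => limn_esup (fun n => (block_dev f l r n)%:E)) @ +oo --> 0%E ->
  forall dl, 0 < dl -> exists K, forall k, (K <= k)%N ->
  exists N, forall n, (N <= n)%N ->
  avg n (fun x => `|orbit_avg f k (tau x w) - l|) <= dl.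
Proof.
move=> h dl dl0.
have nb : nbhs (0%E : \bar R) [set x | (x < dl%:E)%E].
  by apply: open_nbhs_nbhs; split; [exact: open_ereal_lt_ereal|rewrite /= lte_fin].
have [r0 [_ hr0]] := h _ nb.
exists (Num.truncn `|r0|).+1 => k Kk.
have k0 : 0 <= k%:R :> R by [].
have rk : r0 < k%:R.
  apply: le_lt_trans (ler_norm r0) _; apply: lt_le_trans (truncnS_gt _) _.
  by rewrite ler_nat.
have [N hN] := limn_esup_lt (hr0 _ rk).
exists N => n Nn; have := hN n Nn.
by rewrite lte_fin block_devE// natrK => /ltW.
Qed.

(** Averaging block averages over a large cube reproduces the plain average up to a boundary effect,
    by [avg_avg]. *)
Lemma block_dev_averaging f l M : (forall v, `|f v| <= M) ->
  (forall dl, 0 < dl -> exists K, forall k, (K <= k)%N ->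
    exists N, forall n, (N <= n)%N ->
    avg n (fun x => `|orbit_avg f k (tau x w) - l|) <= dl) ->
  avg n (fun x => f (tau x w)) @[n --> \oo] --> l.
Proof.
move=> fM h; apply/cvgrPdist_le => dl dl0.
have M0 : 0 <= M by exact: le_trans (fM w).
have dl2 : 0 < dl / 2 by rewrite divr_gt0.
have [K /(_ K (leqnn K)) [N hN]] := h _ dl2.
have dl1 : 0 < dl / 2 / (M + 1) by rewrite divr_gt0// ltr_wpDl.
have [N' hN'] := avg_avg d K dl1.
exists (maxn N N') => // n /=; rewrite geq_max => /andP[Nn N'n].
have h1 := hN n Nn.
have h2 := hN' n N'n (fun x => f (tau x w)) M (fun x => fM _).
have {}h2 : `|avg n (fun x => orbit_avg f K (tau x w)) - avg n (fun x => f (tau x w))| <= dl / 2.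
  rewrite (_ : avg n (fun x => orbit_avg f K (tau x w)) =
     avg n (fun x => avg K (fun y => f (tau (x + y) w)))).
    rewrite (le_trans h2)// mulrCA ger_pMr// ler_pdivrMr ?mul1r ?lerDl//.
    by rewrite ltr_wpDl.
  congr avg; apply/funext => x; congr avg; apply/funext => y.
  by rewrite tau_tau addrC.
have {}h1 : `|avg n (fun x => orbit_avg f K (tau x w)) - l| <= dl / 2.
  rewrite -[X in _ - X](avg_cst d n) -avgB.
  exact: le_trans (ler_avg_norm _ _) h1.
move: h1 h2; rewrite !ler_norml => /andP[? ?] /andP[? ?].
by apply/andP; split; lra.
Qed.

(** * From constant block averages to the zero-one law *)

Section zero_one.
Variable P : probability (config R d) R.
Hypothesis wP : is_limit_law w P.

(* Functions whose block averages become constant in L^1; [l] may depend on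
   [dl], so that closure under L^1 limits is immediate. *)
Definition flat g : Prop := forall dl : R, 0 < dl -> exists l : R,
  exists K, forall k, (K <= k)%N -> Ex P (fun v => `|orbit_avg g k v - l|) <= dl.

Lemma flat_cst (a : R) : flat (fun=> a).
Proof.
move=> dl dl0; exists a, 0%N => k _; rewrite (_ : (fun _ => _) = fun=> 0).
  by rewrite Ex_cst ltW.
by apply/funext => v; rewrite /orbit_avg avg_cst subrr normr0.
Qed.

Lemma bm_dev g k (l : R) : bm g -> bm (fun v => `|orbit_avg g k v - l|).
Proof. by move=> bg; apply/bm_norm/bmB; [exact: bm_orbit_avg|exact: bm_cst]. Qed.

Lemma flatD g1 g2 : bm g1 -> bm g2 -> flat g1 -> flat g2 ->
  flat (fun v => g1 v + g2 v).
Proof.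
move=> b1 b2 f1 f2 dl dl0; have dl2 : 0 < dl / 2 by rewrite divr_gt0.
have [l1 [K1 h1]] := f1 _ dl2; have [l2 [K2 h2]] := f2 _ dl2.
exists (l1 + l2), (maxn K1 K2) => k; rewrite geq_max => /andP[k1 k2].
rewrite (splitr dl); apply: le_trans (lerD (h1 k k1) (h2 k k2)).
rewrite -ExD; [|exact: bm_dev|exact: bm_dev].
apply: le_Ex => [||v]; first exact/bm_dev/bmD.
  by apply: bmD; exact: bm_dev.
by rewrite /orbit_avg avgD opprD addrACA ler_normD.
Qed.

Lemma flatN g : flat g -> flat (fun v => - g v).
Proof.
move=> fg dl dl0; have [l [K h]] := fg _ dl0; exists (- l), K => k Kk.
have -> : (fun v => `|orbit_avg (fun u => - g u) k v - - l|) =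
    (fun v => `|orbit_avg g k v - l|); last exact: h.
by apply/funext => v; rewrite /orbit_avg avgN -opprD normrN.
Qed.

(** By invariance of [P], orbit averaging contracts the mean of [|g - g'|] for every [k], so the
    approximation error is uniform in [k]. *)
Lemma flat_approx g : bm g -> (forall dl, 0 < dl ->
  exists2 g', bm g' /\ flat g' & Ex P (fun v => `|g v - g' v|) <= dl) -> flat g.
Proof.
move=> bg h dl dl0; have dl2 : 0 < dl / 2 by rewrite divr_gt0.
have [g' [bg' fg'] gg'] := h _ dl2; have [l [K hK]] := fg' _ dl2.
exists l, K => k Kk.
have bgg' : bm (fun v => `|g v - g' v|) by apply/bm_norm/bmB.
rewrite (splitr dl); apply: le_trans (lerD gg' (hK k Kk)).
rewrite -(@Ex_orbit_avg _ _ P _ _ k bgg'); last first.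
  by move=> y u bu; exact: (Ex_tau wP).
rewrite -ExD; [|exact: bm_orbit_avg|exact: bm_dev].
apply: le_Ex => [||v]; first exact: bm_dev.
  by apply: bmD; [exact: bm_orbit_avg|exact: bm_dev].
rewrite -(subrKA (orbit_avg g' k v)) (le_trans (ler_normD _ _))// lerD2r.
by rewrite /orbit_avg -avgB; exact: ler_avg_norm.
Qed.

Lemma flat_sum (n : nat) (F : nat -> config R d -> R) :
  (forall i, bm (F i)) -> (forall i, flat (F i)) ->
  flat (fun v => \sum_(i < n) F i v).
Proof.
move=> bF fF; elim: n => [|n IH].
  by under eq_fun do rewrite big_ord0; exact: flat_cst.
under eq_fun do rewrite big_ord_recr/=.
by apply: flatD => //; exact: (@bm_sum _ _ _ _ _ (fun i : 'I_n => F i)).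
Qed.

Hypothesis tw : tight w.
Hypothesis Cloc_flat : forall f, Cloc f -> flat f.

Lemma Cb_flat f : Cb f -> flat f.
Proof.
move=> Cf; apply: flat_approx; first exact: Cb_bm.
move=> dl dl0; have [h hloc fh] := approx_Cloc_Ex wP tw Cf dl0.
by exists h => //; split; [exact/Cb_bm/Cloc_Cb|exact: Cloc_flat].
Qed.

(** Dynkin's lemma on cozero sets: their indicators are limits in mean of [min 1 (j h)], and
    indicators of disjoint unions are limits in mean of finite sums. *)
Lemma indic_flat (A : set (config R d)) : measurable A -> flat (\1_A).
Proof.
move=> mA; have : <<s @pos_sets R d >> A by rewrite -measurable_pos_sets.
apply: (@dynkin_induction _ (config R d) (@pos_sets R d)
  (fun B => flat (\1_B))).
- exact: measurable_pos_sets.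
- exact: pos_sets_setI.
- rewrite (_ : \1_setT = fun=> 1); first exact: flat_cst.
  by apply/funext => v; rewrite indicE in_setT.
- move=> _ [h [Ch h0] ->]; set B := [set v | _].
  have mB : measurable B by apply: pos_sets_measurable; exists h.
  apply: flat_approx; first exact: bm_indic.
  move=> dl dl0; have /cvgrPdist_le/(_ _ dl0) [j _ /(_ j (leqnn j)) /= hj] := Ex_pos_set (P := P) Ch h0.
  set g := (fun v => 1 - _) in hj; exists g.
    have Cg : Cb g.
      apply: Cb_sub; first exact: Cb_cst.
      by apply: Cb_pos; apply: Cb_sub; [exact: Cb_cst|exact: Cb_scale].
    by split; [exact: Cb_bm|exact: Cb_flat].
  have Cg : Cb g.
    apply: Cb_sub; first exact: Cb_cst.
    by apply: Cb_pos; apply: Cb_sub; [exact: Cb_cst|exact: Cb_scale].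
  rewrite (_ : (fun v => `|_|) = fun v => \1_B v - g v).
    rewrite ExB; [|exact: bm_indic|exact: Cb_bm].
    by rewrite Ex_indic// (le_trans (ler_norm _)).
  apply/funext => v; rewrite ger0_norm// subr_ge0 indicE /g.
  case: (boolP (v \in B)) => [_|/negP vB]; first by rewrite gerBl le_max lexx.
  have -> : h v = 0.
    apply/eqP; rewrite eq_le h0 andbT leNgt; apply/negP => p; apply: vB.
    exact/mem_set.
  rewrite mulr0 subr0.
  by have -> : Num.max 0 1 = 1 :> R; [exact/max_idPr|rewrite subrr].
- move=> B mB fB.
  rewrite (_ : \1_(~` B) = fun v => 1 + - \1_B v).
    by apply: flatD; [exact: bm_cst|exact/bmN/bm_indic|exact: flat_cst|exact: flatN].
  apply/funext => v; rewrite !indicE in_setC.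
  by case: (v \in B); rewrite ?subrr ?subr0.
- move=> F mF tF fF; set U := \bigcup_k F k.
  have mU : measurable U by exact: bigcupT_measurable.
  pose S n v : R := \sum_(i < n) \1_(F i) v.
  have bF i : bm (\1_(F i) : config R d -> R) by exact: bm_indic.
  have bS n : bm (S n) by exact: (@bm_sum _ _ _ _ _ (fun i : 'I_n => \1_(F i) : config R d -> R)).
  (* By disjointness only the summand of index [j] survives. *)
  have SF n v j : F j v -> S n v = (j < n)%N%:R.
    move=> Fj; rewrite /S.
    rewrite (eq_bigr (fun i : 'I_n => ((i : nat) == j)%:R)); last first.
      move=> i _; rewrite indicE; congr (nat_of_bool _)%:R.
      apply/idP/eqP => [/set_mem Fi|->]; last exact/mem_set.
      by move/trivIsetP : tF => tF; apply: contrapT => /eqP ij;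
        have := tF i j I I ij => /seteqP[] /(_ v (conj Fi Fj)).
    elim: n => [|n IH]; first by rewrite big_ord0.
    rewrite big_ord_recr/= IH ltnS [in RHS]leq_eqVlt (eq_sym n j) -natrD.
    by case: (ltngtP j n).
  have S0 n v : ~ U v -> S n v = 0.
    move=> nU; apply: big1 => i _; rewrite indicE; case: (boolP (v \in F i)) => //.
    by move=> /set_mem Fi; exfalso; apply: nU; exists i.
  apply: flat_approx; first exact: bm_indic.
  move=> dl dl0.
  have c : Ex P (fun v => `|\1_U v - S n v|) @[n --> \oo] --> Ex P (fun=> 0).
    apply: (@Ex_cvg _ _ _ P _ _ 1).
    - by move=> n; have [] : bm (fun v => `|\1_U v - S n v|) by apply/bm_norm/bmB => //; exact: bm_indic.
    - exact: measurable_cst.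
    - move=> n v; rewrite normr_id indicE.
      have [[j _ Fj]|nU] := pselect (U v).
        rewrite (SF n v j Fj) mem_set; last by exists j.
        by case: (j < n)%N; rewrite ?subrr ?subr0 ?normr0 ?normr1 ?ler01.
      by rewrite S0// memNset// subrr normr0 ler01.
    - move=> v; rewrite indicE.
      have [[j _ Fj]|nU] := pselect (U v).
        rewrite mem_set; last by exists j.
        apply: cvg_near_cst; exists j.+1 => // n /= jn.
        by rewrite (SF n v j Fj) jn subrr normr0.
      rewrite memNset//; apply: cvg_near_cst; apply: nearW => n.
      by rewrite S0// subrr normr0.
  rewrite Ex_cst in c.
  have /cvgr0Pnorm_le/(_ _ dl0) [n _ /(_ n (leqnn n)) /= hn] := c.
  exists (S n); last exact: le_trans (ler_norm _) hn.
  by split => //; exact: (flat_sum n bF fF).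
Qed.

(** An invariant indicator equals all its orbit averages, hence lies within [dl] in mean of some
    constant [l]. This gives [(1 - l) p <= dl] and [l (1 - p) <= dl]; weighting by [1 - p] and [p]
    and adding gives [p (1 - p) <= dl]. *)
Lemma flat_zero_one (A : set (config R d)) : measurable A ->
  (forall x, tau x @^-1` A = A) -> P A = 0%E \/ P A = 1%E.
Proof.
move=> mA iA; have fA := indic_flat mA.
have oA k : orbit_avg (\1_A) k = \1_A.
  apply/funext => v; rewrite /orbit_avg -[RHS](avg_cst d k); congr avg.
  apply/funext => y; rewrite !indicE; congr (nat_of_bool _)%:R.
  have E : A (tau y v) = A v by exact: (congr1 (fun B : set (config R d) => B v) (iA y)).
  by apply/idP/idP => /set_mem h; apply/mem_set; [rewrite -E|rewrite E].
pose p := fine (P A).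
have pE : P A = p%:E by rewrite /p fineK// fin_num_measure.
have p0 : 0 <= p by rewrite /p fine_ge0.
have p1 : p <= 1 by rewrite -lee_fin -pE probability_le1.
have mC := measurableC mA.
have bA := @bm_indic _ _ R _ mA.
have bC := @bm_indic _ _ R _ mC.
have pq : p * (1 - p) <= 0.
  apply/ler_addgt0Pr => dl dl0; rewrite add0r.
  have [l [K hK]] := fA _ dl0; have := hK K (leqnn K); rewrite oA => h.
  have bl : bm (fun v => `|(\1_A v : R) - l|) by apply/bm_norm/bmB => //; exact: bm_cst.
  have h1 : (1 - l) * p <= dl.
    apply: le_trans h; rewrite /p -(Ex_indic P mA) -ExZ//.
    apply: le_Ex => //; first exact: bmZ.
    move=> v; rewrite indicE; case: (v \in A); first by rewrite mulr1 ler_norm.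
    by rewrite mulr0.
  have h2 : l * (1 - p) <= dl.
    apply: le_trans h.
    have -> : 1 - p = Ex P (\1_(~` A)).
      by rewrite Ex_indic// probability_setC// pE.
    rewrite -ExZ//; apply: le_Ex => //; first exact: bmZ.
    move=> v; rewrite !indicE in_setC; case: (v \in A); first by rewrite mulr0.
    by rewrite mulr1 sub0r normrN ler_norm.
  have q0 : 0 <= 1 - p by rewrite subr_ge0.
  have := ler_wpM2l q0 h1; have := ler_wpM2l p0 h2; nra.
have : p * (1 - p) == 0 by rewrite eq_le pq mulr_ge0// subr_ge0.
rewrite mulf_eq0 subr_eq0 => /orP[/eqP pz|/eqP pz]; rewrite pE pz; [left|right] => //.
Qed.

End zero_one.

End proposition.

Theorem proposition1p5 (R : realType) (d : nat) (hd : (0 < d)%N)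
    (w : config R d) (hw : tight w) :
  (forall f : config R d -> R, Cloc f ->
     exists l : R,
       (fun r : R => limn_esup (fun n : nat =>
         (mean (Lambda d (n%:R : R)) (fun x =>
            `| mean (Lambda d r) (fun y => f (tau (x + y) w)) - l |))%:E))
       @ +oo --> 0%E)
  <-> (averaging w /\ ergodic w).
Proof.
split => [H|[_ [P [wP erg]]] f fl]; last first.
  by exists (Ex P f); exact: block_dev_cvg0.
have small f : Cloc f -> exists l, forall dl, 0 < dl -> exists K, forall k, (K <= k)%N ->
    exists N, forall n, (N <= n)%N ->
    avg n (fun x => `|orbit_avg f k (tau x w) - l|) <= dl.
  by move=> /H [l hl]; exists l; exact: block_dev_small.
have aw : averaging w.
  move=> f fl; have [l hl] := small f fl; have [M fM] := Cloc_bounded fl.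
  apply/cvg_ex; exists l; under eq_fun do rewrite mean_avg.
  exact: block_dev_averaging fM hl.
(* The averaging property has to be established first, since the existence of [P] rests on it. *)
split => //; have [P wP] := limit_law_exists hw aw.
exists P; split => //; apply: (flat_zero_one wP hw) => f fl dl dl0.
have [l hl] := small f fl; exists l; have [K hK] := hl _ dl0; exists K => k Kk.
have [N hN] := hK k Kk.
(* For fixed [k] the deviation is in [Cb], so its expectation is the limit of its orbit averages and
   inherits their eventual bound [dl]. *)
have Cr : Cb (fun v => `|orbit_avg f k v - l|).
  apply: Cb_norm; apply: Cb_sub; last exact: Cb_cst.
  exact/Cb_orbit_avg/Cloc_Cb.
have c := limit_law_cvg wP Cr.
rewrite -(cvg_lim (@Rhausdorff R) c); apply: limr_le.
  by apply/cvg_ex; eexists; exact: c.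
by exists N => // n /= Nn; exact: hN.
Qed.
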